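(* Let $(d_k)_{k=1}^\infty$ and $(N_k)_{k=1}^\infty$ be sequences of natural numbers such that $(d_k)$ is lacunary, $N_k\mid N_{k+1}$ and $N_k<N_{k+1}$ for all $k$. Put \[A_k=\{(n_1,n_2)\in\mathbb{N}\times\mathbb{N}: n_1+n_2=d_k\},\qquad B_k=\{(n_1,n_2)\in A_k: N_k\mid n_1\},\qquad B=\bigcup_{k=1}^\infty B_k.\] Then the following are equivalent: (i) there exist constants $a,C$ such that $d_k\le C N_{k+a}$ for all $k$; (ii) $B$ belongs to the idempotent ring of $H^1(\mathbb{T}\times\mathbb{T})$, i.e. the operator $T$ defined on trigonometric polynomials in $H^1(\mathbb{T}\times\mathbb{T})$ by $\widehat{Tf}=\mathbbm{1}_B\widehat f$ extends to a bounded operator $H^1(\mathbb{T}\times\mathbb{T})\to H^1(\mathbb{T}\times\mathbb{T})$.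
   Context: $\mathbb{N}=\{0,1,2,\dots\}$. A sequence $(d_k)$ of positive integers is lacunary if $\inf_k d_{k+1}/d_k>1$. $\mathbb{T}=\mathbb{R}/2\pi\mathbb{Z}$ with normalized Lebesgue measure. $H^1(\mathbb{T}\times\mathbb{T})$ is the closed linear span in $L^1(\mathbb{T}^2)$ of the characters $e^{i(n_1t_1+n_2t_2)}$ with $n_1,n_2\ge 0$. The idempotent ring of $H^1(\mathbb{T}\times\mathbb{T})$ is the family of sets $E\subset\mathbb{N}\times\mathbb{N}$ for which the Fourier multiplier $\mathbbm{1}_E$ is bounded on $H^1(\mathbb{T}\times\mathbb{T})$. *)

(* Defs.v *)
From Stdlib Require Import Reals Lra List ClassicalDescription.
From Coquelicot Require Import Coquelicot.
Import ListNotations.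
Open Scope R_scope.

Definition lacunary (d : nat -> nat) : Prop :=
  (forall k, (0 < d k)%nat) /\
  exists q : R, 1 < q /\ forall k, q * INR (d k) <= INR (d (S k)).

Definition eC (theta : R) : C := (cos theta, sin theta).

(* An analytic trigonometric polynomial on T^2 (an element of H^1(T x T)),
   given as a finite list of (n1, n2, coefficient) with n1, n2 >= 0. *)
Definition trigpoly := list (nat * nat * C).

Definition trig_eval (p : trigpoly) (t1 t2 : R) : C :=
  fold_right (fun x acc => let '(n1, n2, c) := x in
     Cplus (Cmult c (eC (INR n1 * t1 + INR n2 * t2))) acc) (RtoC 0) p.

Definition L1norm (p : trigpoly) : R :=
  / (4 * PI ^ 2) *
  RInt (fun t1 => RInt (fun t2 => Cmod (trig_eval p t1 t2)) 0 (2 * PI)) 0 (2 * PI).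

Definition ind (E : nat -> nat -> Prop) (n1 n2 : nat) : bool :=
  if excluded_middle_informative (E n1 n2) then true else false.

Definition multiplier (E : nat -> nat -> Prop) (p : trigpoly) : trigpoly :=
  filter (fun x => let '(n1, n2, _) := x in ind E n1 n2) p.

(* E is in the idempotent ring of H^1(T x T): the multiplier 1_E, defined on
   analytic trigonometric polynomials, is bounded in the H^1 (= L^1) norm
   (hence extends to a bounded operator on their closure H^1). *)
Definition in_idempotent_ring (E : nat -> nat -> Prop) : Prop :=
  exists K : R, forall p : trigpoly, L1norm (multiplier E p) <= K * L1norm p.

Definition setB (d N : nat -> nat) (n1 n2 : nat) : Prop :=
  exists k : nat, (n1 + n2)%nat = d k /\ Nat.divide (N k) n1.

(* Main.v *)
Require Import Defs.
From Stdlib Require Import Reals Lra Lia ZArith List ClassicalDescription Classical.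
From Coquelicot Require Import Coquelicot.
Open Scope R_scope.

(** In the coordinates [s = t1 - t2], [t = t2], the line [A_k] is the frequency [d_k] in [t],
    and the multiplier replaces the coefficient [P_k(s)] of [e^{i d_k t}] by its average
    [E_k P_k] over the translations by multiples of [2 pi / N_k].

    If [d_k <= C N_{k+a}], splitting into finitely many subsequences reduces to
    [2 d_k < d_{k+1}] and [8 d_k <= N_{k+1}].  By duality one needs, for a bounded [psi], a
    bounded function whose coefficients in the cone [0 <= m <= n] are those of [psi] on [B],
    up to a constant.  It is built by
    [Phi' = (1 - 4 |beta|^2) Phi + kappa (w - conj w * Phi^2)], [w = beta_k(s) e^{i d_k t}],
    with [beta_k] a smooth truncation of the coefficient of [e^{i d_k t}] in [E_k psi].  The
    last term has only negative frequencies in [t].  The damping factor has frequencies in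
    [N_k Z], beyond the reach of the polynomials of the earlier stages, which therefore only
    see its mean; these means have product at least 3/4 since [sum_k ||beta_k||_2^2 <= 1/16].

    Conversely, if [d_k > 2 N_{k+n}], the same Fejer kernel of order [N_{k+n}] can be put on the
    lines [k, ..., k+n].  This has norm at most [sqrt (n+1)], whereas
    [max_i |E_{k+i} f|] has integral at least [n/24].

    All norms are computed on finite grids, by averaging over translates. *)

(** * Sums, means and characters on a finite grid *)

Fixpoint rsum (n : nat) (f : nat -> R) : R :=
  match n with O => 0 | S m => rsum m f + f m end.

Fixpoint csum (n : nat) (f : nat -> C) : C :=
  match n with O => RtoC 0 | S m => (csum m f + f m)%C end.

Lemma rsum_ext (n : nat) (f g : nat -> R) :
  (forall i, (i < n)%nat -> f i = g i) -> rsum n f = rsum n g.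
Proof.
  induction n as [|n IH]; simpl; intros H; [reflexivity|].
  rewrite IH, H; auto with arith.
Qed.

Lemma rsum_le (n : nat) (f g : nat -> R) :
  (forall i, (i < n)%nat -> f i <= g i) -> rsum n f <= rsum n g.
Proof.
  induction n as [|n IH]; simpl; intros H; [lra|].
  apply Rplus_le_compat; auto with arith.
Qed.

Lemma rsum_plus (n : nat) (f g : nat -> R) :
  rsum n (fun i => f i + g i) = rsum n f + rsum n g.
Proof. induction n as [|n IH]; simpl; [|rewrite IH]; ring. Qed.

Lemma rsum_scal (n : nat) (c : R) (f : nat -> R) :
  rsum n (fun i => c * f i) = c * rsum n f.
Proof. induction n as [|n IH]; simpl; [|rewrite IH]; ring. Qed.

Lemma rsum_const (n : nat) (c : R) : rsum n (fun _ => c) = INR n * c.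
Proof. induction n as [|n IH]; [simpl; ring|]. rewrite S_INR; simpl rsum; rewrite IH; ring. Qed.

Lemma rsum_nonneg (n : nat) (f : nat -> R) :
  (forall i, (i < n)%nat -> 0 <= f i) -> 0 <= rsum n f.
Proof.
  intros H. replace 0 with (rsum n (fun _ => 0)) by (rewrite rsum_const; ring).
  now apply rsum_le.
Qed.

Lemma rsum_swap (n m : nat) (f : nat -> nat -> R) :
  rsum n (fun i => rsum m (fun j => f i j)) = rsum m (fun j => rsum n (fun i => f i j)).
Proof.
  induction n as [|n IH]; simpl.
  - rewrite rsum_const; ring.
  - now rewrite IH, <- rsum_plus.
Qed.

Lemma rsum_add (n m : nat) (f : nat -> R) :
  rsum (n + m) f = rsum n f + rsum m (fun i => f (n + i)%nat).
Proof.
  induction m as [|m IH]; simpl.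
  - rewrite Nat.add_0_r; ring.
  - rewrite Nat.add_succ_r; simpl; rewrite IH; ring.
Qed.

Lemma csum_ext (n : nat) (f g : nat -> C) :
  (forall i, (i < n)%nat -> f i = g i) -> csum n f = csum n g.
Proof.
  induction n as [|n IH]; simpl; intros H; [reflexivity|].
  rewrite IH, H; auto with arith.
Qed.

Lemma csum_plus (n : nat) (f g : nat -> C) :
  csum n (fun i => f i + g i)%C = (csum n f + csum n g)%C.
Proof. induction n as [|n IH]; simpl; [|rewrite IH]; ring. Qed.

Lemma csum_scal (n : nat) (c : C) (f : nat -> C) :
  csum n (fun i => c * f i)%C = (c * csum n f)%C.
Proof. induction n as [|n IH]; simpl; [|rewrite IH]; ring. Qed.

Lemma csum_const (n : nat) (c : C) : csum n (fun _ => c) = (INR n * c)%C.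
Proof.
  induction n as [|n IH]; [simpl; ring|].
  rewrite S_INR, RtoC_plus; simpl csum; rewrite IH; ring.
Qed.

Lemma csum_zero (n : nat) (f : nat -> C) :
  (forall i, (i < n)%nat -> f i = RtoC 0) -> csum n f = RtoC 0.
Proof.
  intros H. rewrite (csum_ext n f (fun _ => RtoC 0)) by auto.
  rewrite csum_const; ring.
Qed.

Lemma csum_conj (n : nat) (f : nat -> C) :
  Cconj (csum n f) = csum n (fun i => Cconj (f i)).
Proof.
  induction n as [|n IH]; simpl.
  - apply injective_projections; simpl; ring.
  - now rewrite Cplus_conj, IH.
Qed.

Lemma csum_swap (n m : nat) (f : nat -> nat -> C) :
  csum n (fun i => csum m (fun j => f i j)) = csum m (fun j => csum n (fun i => f i j)).
Proof.
  induction n as [|n IH]; simpl.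
  - symmetry; now apply csum_zero.
  - now rewrite IH, <- csum_plus.
Qed.

Lemma csum_RtoC (n : nat) (f : nat -> R) : csum n (fun i => RtoC (f i)) = RtoC (rsum n f).
Proof. induction n as [|n IH]; simpl; [|rewrite IH, RtoC_plus]; reflexivity. Qed.

Lemma Cmod_csum (n : nat) (f : nat -> C) : Cmod (csum n f) <= rsum n (fun i => Cmod (f i)).
Proof.
  induction n as [|n IH]; simpl.
  - rewrite Cmod_0; lra.
  - eapply Rle_trans; [apply Cmod_triangle | lra].
Qed.

Lemma csum_single (n x : nat) (f : nat -> C) :
  (x < n)%nat -> (forall i, (i < n)%nat -> i <> x -> f i = RtoC 0) -> csum n f = f x.
Proof.
  induction n as [|n IH]; [lia|]; simpl; intros Hx Hf.
  destruct (Nat.eq_dec x n) as [->|Hn].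
  - rewrite csum_zero; [ring|]. intros i Hi; apply Hf; lia.
  - rewrite IH; [rewrite (Hf n); [ring|lia|lia] | lia | intros; apply Hf; lia].
Qed.

Definition rmean (n : nat) (f : nat -> R) : R := / INR n * rsum n f.
Definition cmean (n : nat) (f : nat -> C) : C := (RtoC (/ INR n) * csum n f)%C.

Lemma rmean_ext (n : nat) (f g : nat -> R) : (forall i, f i = g i) -> rmean n f = rmean n g.
Proof. intros H; unfold rmean; f_equal; apply rsum_ext; auto. Qed.

Lemma inv_INR_nonneg (n : nat) : 0 <= / INR n.
Proof.
  destruct n as [|n].
  - change (INR 0) with 0. rewrite Rinv_0; lra.
  - apply Rlt_le, Rinv_0_lt_compat, lt_0_INR; lia.
Qed.

Lemma rmean_le (n : nat) (f g : nat -> R) : (forall i, f i <= g i) -> rmean n f <= rmean n g.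
Proof.
  intros H; unfold rmean. apply Rmult_le_compat_l; [apply inv_INR_nonneg|].
  apply rsum_le; auto.
Qed.

Lemma rmean_plus (n : nat) (f g : nat -> R) :
  rmean n (fun i => f i + g i) = rmean n f + rmean n g.
Proof. unfold rmean; rewrite rsum_plus; ring. Qed.

Lemma rmean_scal (n : nat) (c : R) (f : nat -> R) :
  rmean n (fun i => c * f i) = c * rmean n f.
Proof. unfold rmean; rewrite rsum_scal; ring. Qed.

Lemma rmean_const (n : nat) (c : R) : (0 < n)%nat -> rmean n (fun _ => c) = c.
Proof.
  intros H; unfold rmean; rewrite rsum_const.
  apply lt_0_INR in H. field; lra.
Qed.

Lemma rmean_nonneg (n : nat) (f : nat -> R) : (forall i, 0 <= f i) -> 0 <= rmean n f.
Proof.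
  intros H; unfold rmean. apply Rmult_le_pos; [apply inv_INR_nonneg|].
  apply rsum_nonneg; auto.
Qed.

Lemma rmean_swap (n m : nat) (f : nat -> nat -> R) :
  rmean n (fun i => rmean m (fun j => f i j)) = rmean m (fun j => rmean n (fun i => f i j)).
Proof.
  unfold rmean. rewrite rsum_scal, rsum_scal, rsum_swap; ring.
Qed.

Lemma rmean_rsum (n m : nat) (f : nat -> nat -> R) :
  rmean n (fun i => rsum m (fun j => f i j)) = rsum m (fun j => rmean n (fun i => f i j)).
Proof. unfold rmean. now rewrite rsum_swap, rsum_scal. Qed.

Lemma cmean_ext (n : nat) (f g : nat -> C) : (forall i, f i = g i) -> cmean n f = cmean n g.
Proof. intros H; unfold cmean; f_equal; apply csum_ext; auto. Qed.

Lemma cmean_plus (n : nat) (f g : nat -> C) :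
  cmean n (fun i => f i + g i)%C = (cmean n f + cmean n g)%C.
Proof. unfold cmean; rewrite csum_plus; ring. Qed.

Lemma cmean_scal (n : nat) (c : C) (f : nat -> C) :
  cmean n (fun i => c * f i)%C = (c * cmean n f)%C.
Proof. unfold cmean; rewrite csum_scal; ring. Qed.

Lemma cmean_const (n : nat) (c : C) : (0 < n)%nat -> cmean n (fun _ => c) = c.
Proof.
  intros H; unfold cmean; rewrite csum_const, Cmult_assoc, <- RtoC_mult.
  apply lt_0_INR in H. rewrite Rinv_l by lra. ring.
Qed.

Lemma cmean_conj (n : nat) (f : nat -> C) :
  Cconj (cmean n f) = cmean n (fun i => Cconj (f i)).
Proof.
  unfold cmean. rewrite Cmult_conj, csum_conj. f_equal.
  apply injective_projections; simpl; ring.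
Qed.

Lemma cmean_csum (n m : nat) (f : nat -> nat -> C) :
  cmean n (fun i => csum m (fun j => f i j)) = csum m (fun j => cmean n (fun i => f i j)).
Proof. unfold cmean. now rewrite csum_swap, csum_scal. Qed.

Lemma cmean_RtoC (n : nat) (f : nat -> R) : cmean n (fun i => RtoC (f i)) = RtoC (rmean n f).
Proof. unfold cmean, rmean. now rewrite csum_RtoC, RtoC_mult. Qed.

Lemma Cmod_cmean (n : nat) (f : nat -> C) : Cmod (cmean n f) <= rmean n (fun i => Cmod (f i)).
Proof.
  unfold cmean, rmean. rewrite Cmod_mult, Cmod_R, Rabs_right by (apply Rle_ge, inv_INR_nonneg).
  apply Rmult_le_compat_l; [apply inv_INR_nonneg | apply Cmod_csum].
Qed.

Lemma Cmod_sqr (z : C) : Cmod z ^ 2 = fst z ^ 2 + snd z ^ 2.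
Proof. unfold Cmod. rewrite pow2_sqrt; [reflexivity|]. nra. Qed.

Lemma Cmul_conj_sqr (z : C) : (z * Cconj z)%C = RtoC (Cmod z ^ 2).
Proof. rewrite Cmod_sqr. apply injective_projections; simpl; ring. Qed.

Lemma Cconj_RtoC (r : R) : Cconj (RtoC r) = RtoC r.
Proof. apply injective_projections; simpl; ring. Qed.

Lemma rmean_sqr (n : nat) (f : nat -> C) :
  RtoC (rmean n (fun i => Cmod (f i) ^ 2)) = cmean n (fun i => f i * Cconj (f i))%C.
Proof.
  rewrite <- cmean_RtoC. apply cmean_ext; intros i. now rewrite Cmul_conj_sqr.
Qed.

(* Expand the nonnegative mean of [w * (x - mu)^2] around the weighted mean [mu]. *)
Lemma rmean_weighted_sqr (n : nat) (w x : nat -> R) :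
  (forall i, 0 <= w i) ->
  rmean n (fun i => w i * x i) ^ 2 <= rmean n w * rmean n (fun i => w i * x i ^ 2).
Proof.
  intros Hw.
  set (A := rmean n w). set (B := rmean n (fun i => w i * x i)).
  set (D := rmean n (fun i => w i * x i ^ 2)).
  assert (HE : forall mu, 0 <= D - 2 * mu * B + mu ^ 2 * A).
  { intros mu.
    replace (D - 2 * mu * B + mu ^ 2 * A)
      with (rmean n (fun i => w i * (x i - mu) ^ 2)).
    - apply rmean_nonneg; intros i. apply Rmult_le_pos; [auto|apply pow2_ge_0].
    - unfold D, B, A.
      rewrite (rmean_ext n _ (fun i => (w i * x i ^ 2 + (- 2 * mu) * (w i * x i)) + mu ^ 2 * w i))
        by (intros; ring).
      rewrite !rmean_plus, !rmean_scal. ring. }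
  assert (HA : 0 <= A) by (apply rmean_nonneg; auto).
  assert (HD : 0 <= D).
  { apply rmean_nonneg; intros i. apply Rmult_le_pos; [auto|apply pow2_ge_0]. }
  destruct (Rle_lt_or_eq_dec 0 A HA) as [Hp|H0].
  - specialize (HE (B / A)).
    replace (D - 2 * (B / A) * B + (B / A) ^ 2 * A) with ((A * D - B ^ 2) / A) in HE by (field; lra).
    assert (0 <= (A * D - B ^ 2) / A * A) by (apply Rmult_le_pos; lra).
    replace ((A * D - B ^ 2) / A * A) with (A * D - B ^ 2) in H by (field; lra). lra.
  - assert (HB : B = 0).
    { destruct (Req_dec B 0) as [|Hn]; [assumption|].
      specialize (HE ((D + 1) / (2 * B))).
      replace (2 * ((D + 1) / (2 * B)) * B) with (D + 1) in HE by (field; lra).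
      rewrite <- H0, Rmult_0_r in HE. lra. }
    rewrite HB, <- H0. lra.
Qed.

Lemma rmean_sqr_le (n : nat) (x : nat -> R) :
  (0 < n)%nat -> rmean n x ^ 2 <= rmean n (fun i => x i ^ 2).
Proof.
  intros Hn. pose proof (rmean_weighted_sqr n (fun _ => 1) x) as H.
  rewrite rmean_const in H by assumption.
  rewrite (rmean_ext n (fun i => 1 * x i) x) in H by (intros; ring).
  rewrite (rmean_ext n (fun i => 1 * x i ^ 2) (fun i => x i ^ 2)) in H by (intros; ring).
  rewrite Rmult_1_l in H. apply H. intros; lra.
Qed.

Lemma eC_plus (a b : R) : eC (a + b) = (eC a * eC b)%C.
Proof.
  unfold eC. rewrite cos_plus, sin_plus. apply injective_projections; simpl; ring.
Qed.

Lemma eC_opp (a : R) : eC (- a) = Cconj (eC a).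
Proof. unfold eC. now rewrite cos_neg, sin_antisym. Qed.

Lemma eC_0 : eC 0 = RtoC 1.
Proof. unfold eC. now rewrite cos_0, sin_0. Qed.

Lemma Cmod_eC (a : R) : Cmod (eC a) = 1.
Proof.
  pose proof (sin2_cos2 a). unfold Rsqr in *.
  transitivity (sqrt 1); [|apply sqrt_1].
  unfold Cmod, eC; simpl. f_equal. lra.
Qed.

Lemma eC_2PI_INR (n : nat) : eC (INR n * (2 * PI)) = RtoC 1.
Proof.
  induction n as [|n IH].
  - simpl. rewrite Rmult_0_l. apply eC_0.
  - rewrite S_INR, Rmult_plus_distr_r, eC_plus, IH, Rmult_1_l.
    unfold eC. rewrite cos_2PI, sin_2PI. apply injective_projections; simpl; ring.
Qed.

Lemma eC_2PI_IZR (z : Z) : eC (IZR z * (2 * PI)) = RtoC 1.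
Proof.
  destruct (Z_le_gt_dec 0 z) as [Hz|Hz].
  - rewrite <- (Z2Nat.id z Hz), <- INR_IZR_INZ. apply eC_2PI_INR.
  - replace (IZR z * (2 * PI)) with (- (INR (Z.to_nat (- z)) * (2 * PI))).
    + rewrite eC_opp, eC_2PI_INR. apply Cconj_RtoC.
    + rewrite INR_IZR_INZ, Z2Nat.id, opp_IZR by lia. ring.
Qed.

Lemma eC_eq_1 (a : R) : eC a = RtoC 1 -> exists k : Z, a = IZR k * (2 * PI).
Proof.
  intros H. injection H as Hc _.
  replace a with (2 * (a / 2)) in Hc by field.
  rewrite cos_2a_sin in Hc.
  assert (Hs : sin (a / 2) = 0) by nra.
  destruct (sin_eq_0_0 _ Hs) as [k Hk]. exists k. lra.
Qed.

Definition ch (M : nat) (n : Z) (j : nat) : C := eC (IZR n * (2 * PI * INR j / INR M)).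

Lemma ch_plus (M : nat) (n m : Z) (j : nat) : ch M (n + m) j = (ch M n j * ch M m j)%C.
Proof. unfold ch. rewrite plus_IZR, Rmult_plus_distr_r. apply eC_plus. Qed.

Lemma ch_opp (M : nat) (n : Z) (j : nat) : ch M (- n) j = Cconj (ch M n j).
Proof. unfold ch. now rewrite opp_IZR, Ropp_mult_distr_l_reverse, eC_opp. Qed.

Lemma ch_0 (M : nat) (j : nat) : ch M 0 j = RtoC 1.
Proof. unfold ch. rewrite Rmult_0_l. apply eC_0. Qed.

Lemma Cmod_ch (M : nat) (n : Z) (j : nat) : Cmod (ch M n j) = 1.
Proof. apply Cmod_eC. Qed.

Lemma ch_mul_conj (M : nat) (n m : Z) (j : nat) :
  (ch M n j * Cconj (ch M m j))%C = ch M (n - m) j.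
Proof. rewrite <- ch_opp, <- ch_plus. reflexivity. Qed.

Lemma cmean_ch_0 (M : nat) : (0 < M)%nat -> cmean M (ch M 0) = RtoC 1.
Proof.
  intros H. rewrite (cmean_ext M _ (fun _ => RtoC 1)) by (intros; apply ch_0).
  now apply cmean_const.
Qed.

Lemma cmean_ch (M : nat) (n : Z) :
  n <> 0%Z -> (Z.abs n < Z.of_nat M)%Z -> cmean M (ch M n) = RtoC 0.
Proof.
  intros Hn HM.
  assert (HMp : 0 < INR M) by (apply lt_0_INR; lia).
  assert (Hgeo : forall k, ((ch M n 1 - 1) * csum k (ch M n) = ch M n k - 1)%C).
  { induction k as [|k IH]; simpl csum.
    - unfold ch. simpl INR. unfold Rdiv. rewrite !Rmult_0_r, Rmult_0_l, Rmult_0_r, eC_0. ring.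
    - rewrite Cmult_plus_distr_l, IH.
      replace (ch M n (S k)) with (ch M n 1 * ch M n k)%C; [ring|].
      unfold ch. rewrite <- eC_plus. f_equal. rewrite (S_INR k). change (INR 1) with 1. field. lra. }
  specialize (Hgeo M).
  assert (HM1 : ch M n M = RtoC 1).
  { unfold ch. rewrite <- (eC_2PI_IZR n). f_equal. field. lra. }
  assert (H1 : ch M n 1 <> RtoC 1).
  { intros H. apply eC_eq_1 in H. destruct H as [k Hk].
    simpl INR in Hk.
    assert (Hk' : IZR n = IZR k * INR M).
    { apply Rmult_eq_reg_r with (2 * PI / INR M).
      - rewrite Rmult_1_r in Hk. rewrite Hk. field. lra.
      - pose proof PI_RGT_0. apply Rgt_not_eq. apply Rdiv_lt_0_compat; lra. }
    rewrite INR_IZR_INZ, <- mult_IZR in Hk'. apply eq_IZR in Hk'.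
    assert (k <> 0%Z) by (intros ->; lia). nia. }
  rewrite HM1 in Hgeo.
  assert (Hs : csum M (ch M n) = RtoC 0).
  { replace (csum M (ch M n)) with ((ch M n 1 - 1) * csum M (ch M n) / (ch M n 1 - 1))%C.
    - rewrite Hgeo. field. intros H; apply H1.
      replace (ch M n 1) with (ch M n 1 - 1 + 1)%C by ring. rewrite H. ring.
    - field. intros H; apply H1.
      replace (ch M n 1) with (ch M n 1 - 1 + 1)%C by ring. rewrite H. ring. }
  unfold cmean. rewrite Hs. ring.
Qed.

Lemma parseval (M A : nat) (f : nat -> Z) (c : nat -> C) :
  (0 < M)%nat ->
  (forall a b, (a < b < A)%nat -> f a <> f b /\ (Z.abs (f a - f b) < Z.of_nat M)%Z) ->
  rmean M (fun j => Cmod (csum A (fun a => c a * ch M (f a) j)%C) ^ 2)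
  = rsum A (fun a => Cmod (c a) ^ 2).
Proof.
  intros HM. induction A as [|A IH]; intros Hf; cbn [csum rsum].
  - rewrite (rmean_ext M _ (fun _ => 0)) by (intros; rewrite Cmod_0; ring).
    now apply rmean_const.
  - rewrite <- IH by (intros; apply Hf; lia).
    apply RtoC_inj. rewrite RtoC_plus, !rmean_sqr.
    set (g := fun j => csum A (fun a => c a * ch M (f a) j)%C).
    assert (Hg : cmean M (fun j => g j * Cconj (c A * ch M (f A) j))%C = RtoC 0).
    { rewrite (cmean_ext M _ (fun j => csum A (fun a =>
         c a * Cconj (c A) * ch M (f a - f A) j)%C)).
      - rewrite cmean_csum. apply csum_zero. intros a Ha.
        rewrite cmean_scal. destruct (Hf a A) as [H1 H2]; [lia|].
        rewrite cmean_ch by lia. ring.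
      - intros j. unfold g. rewrite Cmult_comm, <- csum_scal. apply csum_ext; intros a _.
        rewrite <- ch_mul_conj, Cmult_conj. ring. }
    rewrite (cmean_ext M _ (fun j => (g j * Cconj (g j) + g j * Cconj (c A * ch M (f A) j))
       + (Cconj (g j * Cconj (c A * ch M (f A) j)) + c A * Cconj (c A) * ch M 0 j))%C).
    + rewrite !cmean_plus, Hg, <- cmean_conj, Hg, cmean_scal, cmean_ch_0 by assumption.
      rewrite Cconj_RtoC, Cmul_conj_sqr. unfold g. ring.
    + intros j. fold (g j). change (csum A (fun a => c a * ch M (f a) j)%C) with (g j).
      rewrite ch_0.
      replace (RtoC 1) with (ch M (f A) j * Cconj (ch M (f A) j))%C.
      * rewrite !Cplus_conj, !Cmult_conj, !Cconj_conj. ring.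
      * rewrite ch_mul_conj, Z.sub_diag. apply ch_0.
Qed.

Lemma bessel (M K : nat) (f : nat -> Z) (g : nat -> C) :
  (0 < M)%nat ->
  (forall a b, (a < b < K)%nat -> f a <> f b /\ (Z.abs (f a - f b) < Z.of_nat M)%Z) ->
  rsum K (fun k => Cmod (cmean M (fun j => g j * Cconj (ch M (f k) j))%C) ^ 2)
  <= rmean M (fun j => Cmod (g j) ^ 2).
Proof.
  intros HM Hf.
  set (a := fun k => cmean M (fun j => g j * Cconj (ch M (f k) j))%C).
  set (s := fun j => csum K (fun k => a k * ch M (f k) j)%C).
  assert (HS : rmean M (fun j => Cmod (s j) ^ 2) = rsum K (fun k => Cmod (a k) ^ 2))
    by now apply parseval.
  assert (HX : cmean M (fun j => g j * Cconj (s j))%C = RtoC (rsum K (fun k => Cmod (a k) ^ 2))).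
  { rewrite <- csum_RtoC.
    rewrite (cmean_ext M _ (fun j => csum K (fun k =>
        Cconj (a k) * (g j * Cconj (ch M (f k) j)))%C)).
    - rewrite cmean_csum. apply csum_ext; intros k _. rewrite cmean_scal.
      fold (a k). rewrite <- Cmul_conj_sqr. ring.
    - intros j. unfold s. rewrite csum_conj, <- csum_scal. apply csum_ext; intros k _.
      rewrite Cmult_conj. ring. }
  assert (H : RtoC (rmean M (fun j => Cmod (g j - s j)%C ^ 2))
    = RtoC (rmean M (fun j => Cmod (g j) ^ 2) - rsum K (fun k => Cmod (a k) ^ 2))).
  { rewrite rmean_sqr.
    rewrite (cmean_ext M _ (fun j => (g j * Cconj (g j) + (RtoC (-1)) * (g j * Cconj (s j)))
       + ((RtoC (-1)) * Cconj (g j * Cconj (s j)) + s j * Cconj (s j)))%C).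
    - rewrite !cmean_plus, !cmean_scal, <- cmean_conj, HX, Cconj_RtoC, <- !rmean_sqr, HS.
      rewrite <- !RtoC_mult, <- !RtoC_plus. f_equal. ring.
    - intros j. rewrite Cminus_conj, Cmult_conj, Cconj_conj.
      replace (RtoC (-1)) with (- RtoC 1)%C by (rewrite <- RtoC_opp; reflexivity). ring. }
  apply RtoC_inj in H.
  assert (0 <= rmean M (fun j => Cmod (g j - s j)%C ^ 2)).
  { apply rmean_nonneg; intros; apply pow2_ge_0. }
  change (rsum K (fun k => Cmod (a k) ^ 2) <= rmean M (fun j => Cmod (g j) ^ 2)). lra.
Qed.

(** * Integer spectra of functions on a grid *)

Definition mean2 (Ms Mt : nat) (f : nat -> nat -> C) : C :=
  cmean Ms (fun j => cmean Mt (fun l => f j l)).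

Definition char2 (Ms Mt : nat) (m n : Z) (j l : nat) : C := (ch Ms m j * ch Mt n l)%C.

Definition hat (Ms Mt : nat) (f : nat -> nat -> C) (m n : Z) : C :=
  mean2 Ms Mt (fun j l => f j l * Cconj (char2 Ms Mt m n j l))%C.

Lemma mean2_ext (Ms Mt : nat) (f g : nat -> nat -> C) :
  (forall j l, f j l = g j l) -> mean2 Ms Mt f = mean2 Ms Mt g.
Proof. intros H; apply cmean_ext; intros j; apply cmean_ext; auto. Qed.

Lemma mean2_plus (Ms Mt : nat) (f g : nat -> nat -> C) :
  mean2 Ms Mt (fun j l => f j l + g j l)%C = (mean2 Ms Mt f + mean2 Ms Mt g)%C.
Proof.
  unfold mean2. rewrite <- cmean_plus. apply cmean_ext; intros j. apply cmean_plus.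
Qed.

Lemma mean2_scal (Ms Mt : nat) (c : C) (f : nat -> nat -> C) :
  mean2 Ms Mt (fun j l => c * f j l)%C = (c * mean2 Ms Mt f)%C.
Proof.
  unfold mean2. rewrite <- cmean_scal. apply cmean_ext; intros j. apply cmean_scal.
Qed.

Lemma mean2_conj (Ms Mt : nat) (f : nat -> nat -> C) :
  Cconj (mean2 Ms Mt f) = mean2 Ms Mt (fun j l => Cconj (f j l)).
Proof.
  unfold mean2. rewrite cmean_conj. apply cmean_ext; intros j. apply cmean_conj.
Qed.

Lemma mean2_split (Ms Mt : nat) (f g : nat -> C) :
  mean2 Ms Mt (fun j l => f j * g l)%C = (cmean Ms f * cmean Mt g)%C.
Proof.
  unfold mean2. rewrite (cmean_ext Ms _ (fun j => cmean Mt g * f j)%C).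
  - rewrite cmean_scal. ring.
  - intros j. rewrite cmean_scal. ring.
Qed.

Lemma hat_ext (Ms Mt : nat) (f g : nat -> nat -> C) (m n : Z) :
  (forall j l, f j l = g j l) -> hat Ms Mt f m n = hat Ms Mt g m n.
Proof. intros H; apply mean2_ext; intros j l; now rewrite H. Qed.

Lemma hat_plus (Ms Mt : nat) (f g : nat -> nat -> C) (m n : Z) :
  hat Ms Mt (fun j l => f j l + g j l)%C m n = (hat Ms Mt f m n + hat Ms Mt g m n)%C.
Proof.
  unfold hat. rewrite <- mean2_plus. apply mean2_ext; intros; ring.
Qed.

Lemma hat_scal (Ms Mt : nat) (c : C) (f : nat -> nat -> C) (m n : Z) :
  hat Ms Mt (fun j l => c * f j l)%C m n = (c * hat Ms Mt f m n)%C.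
Proof.
  unfold hat. rewrite <- mean2_scal. apply mean2_ext; intros; ring.
Qed.

Lemma hat_zero (Ms Mt : nat) (f : nat -> nat -> C) (m n : Z) :
  (forall j l, f j l = RtoC 0) -> hat Ms Mt f m n = RtoC 0.
Proof.
  intros H. rewrite (hat_ext Ms Mt f (fun j l => RtoC 0 * f j l)%C).
  - rewrite hat_scal. ring.
  - intros; rewrite H; ring.
Qed.

Lemma hat_char2 (Ms Mt : nat) (m n m' n' : Z) :
  hat Ms Mt (char2 Ms Mt m' n') m n
  = (cmean Ms (ch Ms (m' - m)) * cmean Mt (ch Mt (n' - n)))%C.
Proof.
  unfold hat. rewrite <- mean2_split. apply mean2_ext; intros j l.
  unfold char2. rewrite <- !ch_mul_conj, Cmult_conj. ring.
Qed.

Definition apart (Ms Mt : nat) (m n m' n' : Z) : Prop :=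
  (m' <> m /\ (Z.abs (m' - m) < Z.of_nat Ms)%Z) \/
  (n' <> n /\ (Z.abs (n' - n) < Z.of_nat Mt)%Z).

Lemma hat_char2_apart (Ms Mt : nat) (m n m' n' : Z) :
  apart Ms Mt m n m' n' -> hat Ms Mt (char2 Ms Mt m' n') m n = RtoC 0.
Proof.
  intros [[H1 H2]|[H1 H2]]; rewrite hat_char2.
  - rewrite cmean_ch by lia. ring.
  - rewrite (cmean_ch Mt) by lia. ring.
Qed.

Lemma hat_char2_same (Ms Mt : nat) (m n : Z) :
  (0 < Ms)%nat -> (0 < Mt)%nat -> hat Ms Mt (char2 Ms Mt m n) m n = RtoC 1.
Proof.
  intros. rewrite hat_char2, !Z.sub_diag, !cmean_ch_0 by assumption. ring.
Qed.

(* [S] is a set of integer frequencies: no reduction modulo the grid sizes. *)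
Inductive sp (Ms Mt : nat) (S : Z -> Z -> Prop) : (nat -> nat -> C) -> Prop :=
| sp_zero : forall f, (forall j l, f j l = RtoC 0) -> sp Ms Mt S f
| sp_add : forall m n c g f, S m n -> sp Ms Mt S g ->
    (forall j l, f j l = (c * char2 Ms Mt m n j l + g j l)%C) -> sp Ms Mt S f.

Lemma sp_ext (Ms Mt : nat) (S : Z -> Z -> Prop) (f g : nat -> nat -> C) :
  sp Ms Mt S f -> (forall j l, g j l = f j l) -> sp Ms Mt S g.
Proof.
  intros H He. destruct H as [f Hf | m n c h f Hs Hh Hf].
  - apply sp_zero. intros; now rewrite He.
  - apply (sp_add _ _ _ m n c h); auto. intros; now rewrite He.
Qed.

Lemma sp_mono (Ms Mt : nat) (S S' : Z -> Z -> Prop) (f : nat -> nat -> C) :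
  sp Ms Mt S f -> (forall m n, S m n -> S' m n) -> sp Ms Mt S' f.
Proof.
  intros H HS. induction H as [f Hf | m n c h f Hs Hh IH Hf].
  - now apply sp_zero.
  - apply (sp_add _ _ _ m n c h); auto.
Qed.

Lemma sp_plus (Ms Mt : nat) (S : Z -> Z -> Prop) (f g : nat -> nat -> C) :
  sp Ms Mt S f -> sp Ms Mt S g -> sp Ms Mt S (fun j l => f j l + g j l)%C.
Proof.
  intros H Hg. induction H as [f Hf | m n c h f Hs Hh IH Hf].
  - apply (sp_ext _ _ _ g); auto. intros; rewrite Hf; ring.
  - apply (sp_add _ _ _ m n c (fun j l => h j l + g j l)%C); auto.
    intros; rewrite Hf; ring.
Qed.

Lemma sp_char2 (Ms Mt : nat) (S : Z -> Z -> Prop) (c : C) (m n : Z) :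
  S m n -> sp Ms Mt S (fun j l => c * char2 Ms Mt m n j l)%C.
Proof.
  intros H. apply (sp_add _ _ _ m n c (fun _ _ => RtoC 0)); auto.
  - now apply sp_zero.
  - intros; ring.
Qed.

Lemma sp_csum (Ms Mt : nat) (S : Z -> Z -> Prop) (A : nat) (f : nat -> nat -> nat -> C) :
  (forall a, (a < A)%nat -> sp Ms Mt S (f a)) ->
  sp Ms Mt S (fun j l => csum A (fun a => f a j l)).
Proof.
  induction A as [|A IH]; intros H; cbn [csum].
  - now apply sp_zero.
  - apply sp_plus; auto.
Qed.

Lemma sp_char2_mult (Ms Mt : nat) (S S' : Z -> Z -> Prop) (c : C) (m n : Z) (f : nat -> nat -> C) :
  sp Ms Mt S f -> (forall m' n', S m' n' -> S' (m + m') (n + n'))%Z ->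
  sp Ms Mt S' (fun j l => c * char2 Ms Mt m n j l * f j l)%C.
Proof.
  intros H HS. induction H as [f Hf | m' n' c' h f Hs Hh IH Hf].
  - apply sp_zero. intros; rewrite Hf; ring.
  - apply (sp_add _ _ _ (m + m') (n + n') (c * c')%C
      (fun j l => c * char2 Ms Mt m n j l * h j l)%C); auto.
    intros; rewrite Hf. unfold char2. rewrite !ch_plus. ring.
Qed.

Lemma sp_mult (Ms Mt : nat) (S S' S'' : Z -> Z -> Prop) (f g : nat -> nat -> C) :
  sp Ms Mt S f -> sp Ms Mt S' g ->
  (forall m n m' n', S m n -> S' m' n' -> S'' (m + m') (n + n'))%Z ->
  sp Ms Mt S'' (fun j l => f j l * g j l)%C.
Proof.
  intros H Hg HS. induction H as [f Hf | m n c h f Hs Hh IH Hf].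
  - apply sp_zero. intros; rewrite Hf; ring.
  - apply (sp_ext _ _ _ (fun j l => c * char2 Ms Mt m n j l * g j l + h j l * g j l)%C).
    + apply sp_plus; [|exact IH]. apply (sp_char2_mult _ _ S'); auto.
    + intros; rewrite Hf; ring.
Qed.

Lemma sp_scal (Ms Mt : nat) (S : Z -> Z -> Prop) (c : C) (f : nat -> nat -> C) :
  sp Ms Mt S f -> sp Ms Mt S (fun j l => c * f j l)%C.
Proof.
  intros H. induction H as [f Hf | m n c' h f Hs Hh IH Hf].
  - apply sp_zero. intros; rewrite Hf; ring.
  - apply (sp_add _ _ _ m n (c * c')%C (fun j l => c * h j l)%C); auto.
    intros; rewrite Hf; ring.
Qed.

Lemma sp_conj (Ms Mt : nat) (S S' : Z -> Z -> Prop) (f : nat -> nat -> C) :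
  sp Ms Mt S f -> (forall m n, S m n -> S' (- m) (- n))%Z ->
  sp Ms Mt S' (fun j l => Cconj (f j l)).
Proof.
  intros H HS. induction H as [f Hf | m n c' h f Hs Hh IH Hf].
  - apply sp_zero. intros; rewrite Hf. apply Cconj_RtoC.
  - apply (sp_add _ _ _ (- m) (- n) (Cconj c') (fun j l => Cconj (h j l))); auto.
    intros; rewrite Hf. unfold char2. rewrite !ch_opp, !Cplus_conj, !Cmult_conj. ring.
Qed.

Lemma sp_hat_apart (Ms Mt : nat) (S : Z -> Z -> Prop) (f : nat -> nat -> C) (m n : Z) :
  sp Ms Mt S f -> (forall m' n', S m' n' -> apart Ms Mt m n m' n') ->
  hat Ms Mt f m n = RtoC 0.
Proof.
  intros H HS. induction H as [f Hf | m' n' c' h f Hs Hh IH Hf].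
  - now apply hat_zero.
  - rewrite (hat_ext _ _ _ _ _ _ Hf), hat_plus, hat_scal, IH, hat_char2_apart by auto. ring.
Qed.

(* Nonzero frequencies of [g] move the spectrum of [f] away from [(m, n)], so [g]
   acts on that coefficient as multiplication by its mean. *)
Lemma sp_hat_mult (Ms Mt : nat) (P S : Z -> Z -> Prop) (g f : nat -> nat -> C) (m n : Z) :
  (0 < Ms)%nat -> (0 < Mt)%nat ->
  sp Ms Mt P g -> sp Ms Mt S f ->
  (forall r i, P r i -> i = 0%Z /\ (Z.abs r < Z.of_nat Ms)%Z) ->
  (forall r m' n', P r 0%Z -> r <> 0%Z -> S m' n' -> apart Ms Mt m n (r + m') n') ->
  hat Ms Mt (fun j l => g j l * f j l)%C m n = (hat Ms Mt g 0 0 * hat Ms Mt f m n)%C.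
Proof.
  intros HMs HMt Hg Hf HP HS. induction Hg as [g Hz | r i c h g Hr Hh IH He].
  - rewrite hat_zero by (intros; rewrite Hz; ring). rewrite (hat_zero _ _ g) by auto. ring.
  - destruct (HP r i Hr) as [-> Hr'].
    rewrite (hat_ext _ _ g _ _ _ He), hat_plus, hat_scal.
    rewrite (hat_ext _ _ _ (fun j l => c * char2 Ms Mt r 0 j l * f j l + h j l * f j l)%C)
      by (intros; rewrite He; ring).
    rewrite hat_plus, IH.
    destruct (Z.eq_dec r 0) as [->|Hr0].
    + rewrite hat_char2_same by assumption.
      rewrite (hat_ext _ _ _ (fun j l => c * f j l)%C), hat_scal; [ring|].
      intros; unfold char2; rewrite !ch_0; ring.
    + rewrite (hat_char2_apart _ _ 0 0) by (left; lia).
      rewrite (sp_hat_apart Ms Mt (fun a b => exists m', a = (r + m')%Z /\ S m' b)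
        (fun j l => c * char2 Ms Mt r 0 j l * f j l)%C m n); [ring| |].
      * apply (sp_char2_mult _ _ S); [assumption|]. intros m' n' H; exists m'.
        split; [lia|]. now replace (0 + n')%Z with n' by lia.
      * intros a b (m' & -> & H). now apply HS.
Qed.

(* Schur's algorithm adds [w] to a function bounded by 1 through
   [phi -> (phi + w) / (1 + conj w * phi)]; this is its expansion to second order. *)
Lemma schur_step_bound (phi beta w : C) :
  Cmod phi <= 1 -> Cmod beta <= 1 / 4 -> Cmod w <= Cmod beta ->
  Cmod ((1 - 4 * (beta * Cconj beta)) * phi + (w - Cconj w * (phi * phi)))%C <= 1.
Proof.
  intros Hphi Hbeta Hw.
  rewrite Cmul_conj_sqr.
  assert (H1 : 0 <= Cmod beta) by apply Cmod_ge_0.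
  assert (H2 : 0 <= Cmod w) by apply Cmod_ge_0.
  assert (H3 : 0 <= Cmod phi) by apply Cmod_ge_0.
  set (b := Cmod beta ^ 2) in *.
  assert (Hb : 0 <= b <= 1 / 16) by (unfold b; nra).
  assert (Hwb : Cmod w ^ 2 <= b) by (unfold b; nra).
  assert (HU : 0 <= Cmod phi ^ 2 <= 1) by nra.
  rewrite Cmod_sqr in Hwb, HU.
  destruct phi as [p q]. destruct w as [x y].
  cbn [fst snd] in Hwb, HU.
  apply Rsqr_incr_0_var; [|lra]. rewrite Rsqr_1, Rsqr_pow2, Cmod_sqr.
  cbn -[pow].
  set (X := x * p + y * q). set (U := p ^ 2 + q ^ 2) in *. set (V := x ^ 2 + y ^ 2) in *.
  assert (Hid : forall r i,
     r = (1 - 4 * b) * p + (x - (x * (p * p - q * q) + y * (p * q + q * p))) ->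
     i = (1 - 4 * b) * q + (y - (x * (p * q + q * p) - y * (p * p - q * q))) ->
     r ^ 2 + i ^ 2 = (1 - 4 * b) ^ 2 * U + 2 * (1 - 4 * b) * (1 - U) * X - 4 * X ^ 2
       + V * (1 + U) ^ 2).
  { intros r i -> ->. unfold U, V, X. ring. }
  rewrite (Hid _ _) by ring.
  assert (HV : 0 <= V) by (unfold V; nra).
  assert (Hsq : 2 * (1 - 4 * b) * (1 - U) * X - 4 * X ^ 2 <= (1 - 4 * b) ^ 2 * (1 - U) ^ 2 / 4).
  { pose proof (pow2_ge_0 ((1 - 4 * b) * (1 - U) / 2 - 2 * X)). nra. }
  assert (HVU : V * (1 + U) ^ 2 <= b * (1 + U) ^ 2).
  { apply Rmult_le_compat_r; [apply pow2_ge_0|lra]. }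
  assert (HUU : U ^ 2 <= U) by nra.
  assert (Hfin : (1 - 4 * b) ^ 2 * U + (1 - 4 * b) ^ 2 * (1 - U) ^ 2 / 4 + b * (1 + U) ^ 2 <= 1).
  { assert (Ha : (1 - 4 * b) ^ 2 <= 1 - 7 * b) by nra.
    assert (Hc : (1 - U) ^ 2 <= 1 - U) by nra.
    assert (Hd : (1 + U) ^ 2 <= 1 + 3 * U) by nra.
    assert (He : (1 - 4 * b) ^ 2 * (U + (1 - U) ^ 2 / 4) <= (1 - 7 * b) * (U + (1 - U) / 4)).
    { apply Rmult_le_compat; try nra. }
    assert (Hf : b * (1 + U) ^ 2 <= b * (1 + 3 * U)) by (apply Rmult_le_compat_l; lra).
    nra. }
  lra.
Qed.

Lemma rmean_kernel_factor (M A N : nat) (u : nat) :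
  (1 <= N)%nat -> (N * A <= M)%nat -> (0 < M)%nat ->
  rmean M (fun j => Cmod (csum A (fun a => Cconj (ch M (Z.of_nat (N * a)) u)
     * ch M (Z.of_nat (N * a)) j)%C) ^ 2) = INR A /\
  rmean M (fun j => Cmod (csum A (fun a => Cconj (ch M (Z.of_nat (N * a)) j)
     * ch M (Z.of_nat (N * a)) u)%C) ^ 2) = INR A.
Proof.
  intros HN HA HM. split.
  - rewrite (parseval M A (fun a => Z.of_nat (N * a))
      (fun a => Cconj (ch M (Z.of_nat (N * a)) u))).
    + rewrite (rsum_ext _ _ (fun _ => 1)), rsum_const; [ring|].
      intros; rewrite Cmod_conj, Cmod_ch; ring.
    + assumption.
    + intros a b Hab. nia.
  - rewrite (rmean_ext M _ (fun j => Cmod (csum A (fun a => ch M (Z.of_nat (N * a)) u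
     * ch M (- Z.of_nat (N * a)) j)%C) ^ 2)).
    + rewrite (parseval M A (fun a => - Z.of_nat (N * a))%Z
        (fun a => (ch M (Z.of_nat (N * a)) u))).
      * rewrite (rsum_ext _ _ (fun _ => 1)), rsum_const; [ring|].
        intros; rewrite Cmod_ch; ring.
      * assumption.
      * intros a b Hab. nia.
    + intros j. f_equal. f_equal. apply csum_ext; intros a _. rewrite ch_opp. ring.
Qed.

(* Convolution with a de la Vallee-Poussin kernel on the multiples of [N]: its
   multiplier is [1] on [[0, D]] and vanishes off [[-D, 2D]]. *)
Lemma band_limited_projection (Ms Mt N D : nat) (g : nat -> C) :
  (1 <= N)%nat -> (4 * D + N < Ms)%nat -> (forall u, Cmod (g u) <= 1) ->
  exists beta : nat -> C,
    (forall j, Cmod (beta j) <= 1 / 4) /\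
    rmean Ms (fun j => Cmod (beta j) ^ 2) <= 1 / 16 * rmean Ms (fun u => Cmod (g u) ^ 2) /\
    sp Ms Mt (fun m n => n = 0%Z /\ (Z.of_nat N | m)%Z /\
                 (- Z.of_nat D <= m <= 2 * Z.of_nat D)%Z) (fun j l => beta j) /\
    (forall m : nat, (m <= D)%nat ->
       cmean Ms (fun j => beta j * Cconj (ch Ms (Z.of_nat m) j))%C =
       (RtoC (1 / 6) * (if Nat.eqb (m mod N) 0
          then cmean Ms (fun u => g u * Cconj (ch Ms (Z.of_nat m) u))%C else 0))%C).
Proof.
  intros HN HMs Hg.
  set (q := (D / N)%nat).
  assert (Hq : (N * q <= D)%nat) by (apply Nat.Div0.mul_div_le).
  set (X := fun A (j u : nat) => csum A (fun a => Cconj (ch Ms (Z.of_nat (N * a)) u)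
     * ch Ms (Z.of_nat (N * a)) j)%C).
  set (Q := INR (q + 1)).
  assert (HQ : 1 <= Q) by (unfold Q; rewrite plus_INR; pose proof (pos_INR q); simpl; lra).
  set (Kk := fun j u => (RtoC (/ Q) * (X (2 * q + 1)%nat j u * Cconj (X (q + 1)%nat j u)))%C).
  assert (HKb : forall j u, Cmod (Kk j u) <=
     / (2 * Q) * Cmod (X (2 * q + 1)%nat j u) ^ 2 + / (2 * Q) * Cmod (X (q + 1)%nat j u) ^ 2).
  { intros j u. unfold Kk. rewrite !Cmod_mult, Cmod_conj, Cmod_R.
    rewrite Rabs_right by (apply Rle_ge, Rlt_le, Rinv_0_lt_compat; lra).
    rewrite Rinv_mult.
    assert (0 < / Q) by (apply Rinv_0_lt_compat; lra).
    pose proof (pow2_ge_0 (Cmod (X (2 * q + 1)%nat j u) - Cmod (X (q + 1)%nat j u))). nra. }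
  assert (Hcst : / (2 * Q) * INR (2 * q + 1) + / (2 * Q) * INR (q + 1) <= 3 / 2).
  { fold Q. replace (INR (2 * q + 1)) with (2 * Q - 1).
    - apply Rmult_le_reg_l with Q; [lra|].
      replace (Q * (/ (2 * Q) * (2 * Q - 1) + / (2 * Q) * Q)) with ((3 * Q - 1) / 2) by (field; lra).
      lra.
    - unfold Q. rewrite !plus_INR, mult_INR. simpl. ring. }
  assert (HM : (0 < Ms)%nat) by lia.
  assert (HKu : forall j, rmean Ms (fun u => Cmod (Kk j u)) <= 3 / 2).
  { intros j. eapply Rle_trans; [apply rmean_le; intros u; apply HKb|].
    rewrite rmean_plus, !rmean_scal. unfold X.
    destruct (rmean_kernel_factor Ms (2 * q + 1) N j) as [_ ->]; [lia|nia|lia|].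
    destruct (rmean_kernel_factor Ms (q + 1) N j) as [_ ->]; [lia|nia|lia|]. exact Hcst. }
  assert (HKj : forall u, rmean Ms (fun j => Cmod (Kk j u)) <= 3 / 2).
  { intros u. eapply Rle_trans; [apply rmean_le; intros j; apply HKb|].
    rewrite rmean_plus, !rmean_scal. unfold X.
    destruct (rmean_kernel_factor Ms (2 * q + 1) N u) as [-> _]; [lia|nia|lia|].
    destruct (rmean_kernel_factor Ms (q + 1) N u) as [-> _]; [lia|nia|lia|]. exact Hcst. }
  set (gh := fun m => cmean Ms (fun u => g u * Cconj (ch Ms m u))%C).
  set (beta := fun j => cmean Ms (fun u => RtoC (1 / 6) * (g u * Kk j u))%C).
  assert (Hbm : forall j, Cmod (beta j) <= rmean Ms (fun u => Cmod (Kk j u) * (1 / 6 * Cmod (g u)))).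
  { intros j. eapply Rle_trans; [apply Cmod_cmean|]. apply rmean_le; intros u.
    rewrite !Cmod_mult, Cmod_R, Rabs_right by lra. lra. }
  assert (Hexp : forall j, beta j = csum (q + 1)%nat (fun b => csum (2 * q + 1)%nat (fun a =>
      RtoC (1 / 6) * RtoC (/ Q) * gh (Z.of_nat (N * a) - Z.of_nat (N * b))%Z
      * ch Ms (Z.of_nat (N * a) - Z.of_nat (N * b)) j)%C)).
  { intros j. unfold beta.
    rewrite (cmean_ext Ms _ (fun u => csum (q + 1)%nat (fun b => csum (2 * q + 1)%nat (fun a =>
      (RtoC (1 / 6) * RtoC (/ Q) * ch Ms (Z.of_nat (N * a) - Z.of_nat (N * b)) j) *
       (g u * Cconj (ch Ms (Z.of_nat (N * a) - Z.of_nat (N * b)) u)))%C))).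
    - rewrite cmean_csum. apply csum_ext; intros b _.
      rewrite cmean_csum. apply csum_ext; intros a _.
      rewrite cmean_scal. unfold gh. ring.
    - intros u. unfold Kk, X. rewrite csum_conj.
      transitivity (RtoC (1 / 6) * RtoC (/ Q) * g u * csum (2 * q + 1)%nat
        (fun a => Cconj (ch Ms (Z.of_nat (N * a)) u) * ch Ms (Z.of_nat (N * a)) j)%C
        * csum (q + 1)%nat (fun i => Cconj (Cconj (ch Ms (Z.of_nat (N * i)) u)
                                 * ch Ms (Z.of_nat (N * i)) j)%C))%C; [ring|].
      rewrite <- csum_scal. apply csum_ext; intros b _.
      rewrite Cmult_comm, Cmult_assoc, <- csum_scal. apply csum_ext; intros a _.
      rewrite <- !ch_mul_conj, !Cmult_conj, !Cconj_conj. ring. }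
  exists beta. repeat split.
  - intros j. eapply Rle_trans; [apply Hbm|].
    eapply Rle_trans; [apply rmean_le with (g := fun u => 1 / 6 * Cmod (Kk j u))|].
    + intros u. pose proof (Hg u). pose proof (Cmod_ge_0 (Kk j u)). nra.
    + rewrite rmean_scal. specialize (HKu j). lra.
  - assert (Hpt : forall j, Cmod (beta j) ^ 2 <=
        1 / 24 * rmean Ms (fun u => Cmod (Kk j u) * Cmod (g u) ^ 2)).
    { intros j.
      assert (H0 : 0 <= Cmod (beta j)) by apply Cmod_ge_0.
      eapply Rle_trans; [apply pow_incr; split; [exact H0 | apply Hbm]|].
      eapply Rle_trans; [apply (rmean_weighted_sqr Ms (fun u => Cmod (Kk j u)) (fun u => 1 / 6 * Cmod (g u)));
        intros; apply Cmod_ge_0|].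
      cbv beta.
      rewrite (rmean_ext Ms (fun i => Cmod (Kk j i) * (1 / 6 * Cmod (g i)) ^ 2)
        (fun i => 1 / 36 * (Cmod (Kk j i) * Cmod (g i) ^ 2))) by (intros; field).
      rewrite rmean_scal.
      assert (0 <= rmean Ms (fun u => Cmod (Kk j u) * Cmod (g u) ^ 2)).
      { apply rmean_nonneg; intros u. apply Rmult_le_pos; [apply Cmod_ge_0 | apply pow2_ge_0]. }
      specialize (HKu j). nra. }
    eapply Rle_trans; [apply rmean_le; exact Hpt|].
    rewrite rmean_scal, rmean_swap.
    eapply Rle_trans; [apply Rmult_le_compat_l; [lra|];
      apply rmean_le with (g := fun u => 3 / 2 * Cmod (g u) ^ 2)|].
    + intros u. rewrite (rmean_ext Ms _ (fun j => Cmod (g u) ^ 2 * Cmod (Kk j u))) by (intros; ring).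
      rewrite rmean_scal. specialize (HKj u). pose proof (pow2_ge_0 (Cmod (g u))). nra.
    + rewrite rmean_scal. lra.
  - apply (sp_ext _ _ _ (fun j l => csum (q + 1)%nat (fun b => csum (2 * q + 1)%nat (fun a =>
      RtoC (1 / 6) * RtoC (/ Q) * gh (Z.of_nat (N * a) - Z.of_nat (N * b))%Z
      * char2 Ms Mt (Z.of_nat (N * a) - Z.of_nat (N * b)) 0 j l)%C))).
    + apply sp_csum; intros b Hb. apply sp_csum; intros a Ha. apply sp_char2.
      split; [reflexivity|]. split; [|nia].
      exists (Z.of_nat a - Z.of_nat b)%Z. lia.
    + intros j l. rewrite Hexp. apply csum_ext; intros b _. apply csum_ext; intros a _.
      unfold char2. rewrite ch_0. ring.
  - intros m Hm.
    rewrite (cmean_ext Ms _ (fun j => csum (q + 1)%nat (fun b => csum (2 * q + 1)%nat (fun a =>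
      RtoC (1 / 6) * RtoC (/ Q) * gh (Z.of_nat (N * a) - Z.of_nat (N * b))%Z
      * ch Ms (Z.of_nat (N * a) - Z.of_nat (N * b) - Z.of_nat m) j)%C))).
    2:{ intros j. rewrite Hexp, Cmult_comm, <- csum_scal. apply csum_ext; intros b _.
        rewrite <- csum_scal. apply csum_ext; intros a _.
        rewrite <- (ch_mul_conj _ _ (Z.of_nat m)). ring. }
    rewrite cmean_csum.
    assert (Hz : forall a b, (a < 2 * q + 1)%nat -> (b < q + 1)%nat ->
        (Z.of_nat (N * a) - Z.of_nat (N * b) <> Z.of_nat m)%Z ->
        cmean Ms (fun j => RtoC (1 / 6) * RtoC (/ Q) * gh (Z.of_nat (N * a) - Z.of_nat (N * b))%Z
          * ch Ms (Z.of_nat (N * a) - Z.of_nat (N * b) - Z.of_nat m) j)%C = RtoC 0).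
    { intros a b Ha Hb Hne. rewrite cmean_scal, cmean_ch; [ring|lia|nia]. }
    destruct (Nat.eqb_spec (m mod N) 0) as [Hd|Hd].
    + apply Nat.Lcm0.mod_divide in Hd. destruct Hd as [i Hi].
      assert (Hiq : (i <= q)%nat) by (apply Nat.div_le_lower_bound; lia).
      rewrite (csum_ext _ _ (fun _ => RtoC (1 / 6) * RtoC (/ Q) * gh (Z.of_nat m))%C).
      * rewrite csum_const. fold Q. fold (gh (Z.of_nat m)).
        transitivity (RtoC (Q * / Q) * RtoC (1 / 6) * gh (Z.of_nat m))%C.
        -- rewrite RtoC_mult. ring.
        -- rewrite Rinv_r by lra. ring.
      * intros b Hb. rewrite cmean_csum.
        rewrite (csum_single _ (b + i)); [|lia|].
        -- replace (Z.of_nat (N * (b + i)) - Z.of_nat (N * b))%Z with (Z.of_nat m) by nia.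
           rewrite cmean_scal, Z.sub_diag, cmean_ch_0 by assumption. ring.
        -- intros a Ha Hne. apply Hz; nia.
    + rewrite csum_zero; [ring|]. intros b Hb. rewrite cmean_csum. apply csum_zero.
      intros a Ha. apply Hz; try assumption. intros He. apply Hd.
      apply Nat.Lcm0.mod_divide. exists (a - b)%nat. nia.
Qed.

(** * The dual function *)

Fixpoint neg_degree (d : nat -> nat) (K : nat) : nat :=
  match K with O => O | S k => (2 * neg_degree d k + d k)%nat end.

Lemma neg_degree_le (d : nat -> nat) (K L : nat) :
  (K <= L)%nat -> (neg_degree d K <= neg_degree d L)%nat.
Proof. induction 1; simpl; lia. Qed.

Definition prev_degree (d : nat -> nat) (K : nat) : nat :=
  match K with O => O | S k => d k end.

Lemma doubling_mono (d : nat -> nat) :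
  (forall k, (2 * d k < d (S k))%nat) -> forall k l, (k <= l)%nat -> (d k <= d l)%nat.
Proof. intros H k l Hkl. induction Hkl as [|l _ IH]; [lia|]. specialize (H l). lia. Qed.

Lemma doubling_lt (d : nat -> nat) :
  (forall k, (2 * d k < d (S k))%nat) -> forall k l, (k < l)%nat -> (d k < d l)%nat.
Proof.
  intros H k l Hkl. apply Nat.lt_le_trans with (d (S k)).
  - specialize (H k). lia.
  - now apply doubling_mono.
Qed.

Definition row (Mt : nat) (psi : nat -> nat -> C) (n : nat) (u : nat) : C :=
  cmean Mt (fun l => psi u l * Cconj (ch Mt (Z.of_nat n) l))%C.

Definition row_energy (Ms Mt : nat) (psi : nat -> nat -> C) (n : nat) : R :=
  rmean Ms (fun u => Cmod (row Mt psi n u) ^ 2).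

Lemma hat_row (Ms Mt : nat) (psi : nat -> nat -> C) (m : Z) (n : nat) :
  hat Ms Mt psi m (Z.of_nat n) = cmean Ms (fun u => row Mt psi n u * Cconj (ch Ms m u))%C.
Proof.
  unfold hat, mean2, row. apply cmean_ext; intros u.
  rewrite Cmult_comm, <- cmean_scal. apply cmean_ext; intros l.
  unfold char2. rewrite Cmult_conj. ring.
Qed.

(* Fournier's dual proof of Paley's inequality, run with coefficients [beta_k] depending
   on the first variable.  [psi] is only required to be bounded, and the weight
   [kappa] comes from replacing the damping factors [1 - 4 |beta_k|^2] by their means. *)
Lemma bounded_interpolation (d N : nat -> nat) (L Ms Mt : nat) (psi : nat -> nat -> C) :
  (forall k, (1 <= d k)%nat) ->
  (forall k, (2 * d k < d (S k))%nat) ->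
  (forall k, (8 * d k <= N (S k))%nat) ->
  (forall k, (1 <= N k)%nat) ->
  (forall k, (k <= L)%nat -> (10 * d L + N k < Ms)%nat) ->
  (neg_degree d L + d L < Mt)%nat ->
  (forall j l, Cmod (psi j l) <= 1) ->
  forall K, (K <= L)%nat ->
  exists (Phi : nat -> nat -> C) (kappa : R),
    (forall j l, Cmod (Phi j l) <= 1) /\
    sp Ms Mt (fun m n => (- Z.of_nat (neg_degree d K) <= n < 0)%Z \/
       ((0 <= n <= Z.of_nat (prev_degree d K))%Z /\
        (Z.abs m <= 6 * Z.of_nat (prev_degree d K))%Z)) Phi /\
    0 <= kappa <= 1 /\
    1 - 1 / 4 * rsum K (fun k => row_energy Ms Mt psi (d k)) <= kappa /\
    (forall m n : nat, (m <= n)%nat -> (n <= d L)%nat ->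
       hat Ms Mt Phi (Z.of_nat m) (Z.of_nat n) = csum K (fun k =>
         RtoC (kappa / 6) * (if (Nat.eqb n (d k) && Nat.eqb (m mod N k)%nat 0%nat)%bool
                then hat Ms Mt psi (Z.of_nat m) (Z.of_nat n) else 0))%C).
Proof.
  intros Hd1 Hd HdN HN HMs HMt Hpsi.
  pose proof (doubling_mono d Hd) as Hmono.
  assert (HMs0 : (0 < Ms)%nat) by (specialize (HMs 0%nat); lia).
  assert (HMt0 : (0 < Mt)%nat) by lia.
  induction K as [|K IH]; intros HK.
  { exists (fun _ _ => RtoC 0), 1. repeat split; simpl; try lra.
    - intros; rewrite Cmod_0; lra.
    - now apply sp_zero.
    - intros. now apply hat_zero. }
  destruct IH as (Phi & kappa & HPb & HPs & Hk01 & Hkl & HPh); [lia|].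
  assert (HKL : (d K <= d L)%nat) by (apply Hmono; lia).
  assert (HDK : (2 * prev_degree d K < d K)%nat /\ (8 * prev_degree d K <= N K)%nat).
  { destruct K as [|k]; cbn [prev_degree].
    - specialize (Hd1 0%nat). lia.
    - specialize (Hd k). specialize (HdN k). lia. }
  destruct HDK as [HDK HDN]. specialize (HN K).
  pose proof (neg_degree_le d (S K) L HK) as Hneg. cbn [neg_degree] in Hneg.
  set (D := prev_degree d K) in *.
  assert (HMsK : (10 * d L + N K < Ms)%nat) by (apply HMs; lia).
  destruct (band_limited_projection Ms Mt (N K) (d K) (row Mt psi (d K)))
    as (beta & Hb1 & Hb2 & Hb3 & Hb4); [assumption|lia| |].
  { intros u. unfold row. eapply Rle_trans; [apply Cmod_cmean|].
    rewrite <- (rmean_const Mt 1) by assumption. apply rmean_le; intros l.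
    rewrite Cmod_mult, Cmod_conj, Cmod_ch, Rmult_1_r. apply Hpsi. }
  fold (row_energy Ms Mt psi (d K)) in Hb2.
  set (v := rmean Ms (fun j => Cmod (beta j) ^ 2)) in *.
  assert (Hv : 0 <= v <= 1 / 16).
  { split; [apply rmean_nonneg; intros; apply pow2_ge_0|].
    unfold v. rewrite <- (rmean_const Ms (1 / 16)) by assumption. apply rmean_le; intros j.
    specialize (Hb1 j). pose proof (Cmod_ge_0 (beta j)). nra. }
  set (kappa' := kappa * (1 - 4 * v)).
  assert (Hk' : 0 <= kappa' <= 1) by (unfold kappa'; nra).
  set (w := fun j l => (RtoC kappa' * (beta j * ch Mt (Z.of_nat (d K)) l))%C).
  set (gam := fun j (l : nat) => (1 - 4 * (beta j * Cconj (beta j)))%C).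
  set (neg := fun j l => (Cconj (w j l) * (Phi j l * Phi j l))%C).
  assert (Hgs : sp Ms Mt (fun m n => n = 0%Z /\ (Z.of_nat (N K) | m)%Z /\
                 (- 3 * Z.of_nat (d K) <= m <= 3 * Z.of_nat (d K))%Z) gam).
  { apply (sp_ext _ _ _ (fun j l => 1 * char2 Ms Mt 0 0 j l +
        (RtoC (-4)) * (beta j * Cconj (beta j)))%C).
    - apply sp_plus.
      + apply sp_char2. split; [reflexivity|]. split; [apply Z.divide_0_r | lia].
      + apply sp_scal. eapply sp_mult; [exact Hb3 | |].
        * eapply (sp_conj Ms Mt _ (fun m n => n = 0%Z /\ (Z.of_nat (N K) | m)%Z /\
             (- 2 * Z.of_nat (d K) <= m <= Z.of_nat (d K))%Z) _ Hb3).
          intros m n (-> & Hm & Hr). split; [reflexivity|].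
          split; [now apply Z.divide_opp_r | lia].
        * cbv beta. intros m n m' n' (-> & Hm & Hr) (-> & Hm' & Hr').
          split; [reflexivity|]. split; [now apply Z.divide_add_r | lia].
    - intros j l. unfold gam, char2. rewrite !ch_0.
      replace (RtoC (-4)) with (- RtoC 4)%C by (rewrite <- RtoC_opp; reflexivity). ring. }
  assert (Hws : sp Ms Mt (fun m n => n = Z.of_nat (d K) /\
                 (- Z.of_nat (d K) <= m <= 2 * Z.of_nat (d K))%Z) w).
  { apply (sp_ext _ _ _ (fun j l => RtoC kappa' * char2 Ms Mt 0 (Z.of_nat (d K)) j l * beta j)%C).
    - eapply sp_char2_mult; [exact Hb3|]. cbv beta. intros m n (-> & _ & Hr). lia.
    - intros j l. unfold w, char2. rewrite ch_0. ring. }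
  assert (Hns : sp Ms Mt (fun m n => - Z.of_nat (neg_degree d (S K)) <= n < 0)%Z neg).
  { eapply (sp_mult Ms Mt (fun m n => n = - Z.of_nat (d K))%Z
      (fun m n => - 2 * Z.of_nat (neg_degree d K) <= n <= 2 * Z.of_nat D)%Z).
    - eapply sp_conj; [exact Hws|]. cbv beta. intros m n [-> _]. lia.
    - eapply sp_mult; [exact HPs | exact HPs |]. cbv beta. intros. lia.
    - cbv beta. cbn [neg_degree]. intros m n m' n' -> Hn'. lia. }
  assert (Hvanish : forall m n : nat, hat Ms Mt neg (Z.of_nat m) (Z.of_nat n) = RtoC 0
     \/ (d L < n)%nat).
  { intros m n. destruct (le_lt_dec n (d L)) as [Hn|Hn]; [left|now right].
    apply (sp_hat_apart _ _ _ _ _ _ Hns). intros m' n' Hn'. cbn [neg_degree] in Hn'.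
    right. lia. }
  exists (fun j l => gam j l * Phi j l + (w j l - neg j l))%C, kappa'.
  repeat split.
  - intros j l. apply schur_step_bound; auto.
    unfold w. rewrite !Cmod_mult, Cmod_ch, Cmod_R, Rabs_right by lra.
    pose proof (Cmod_ge_0 (beta j)). nra.
  - apply sp_plus; [|apply (sp_ext _ _ _ (fun j l => w j l + RtoC (-1) * neg j l)%C);
      [apply sp_plus; [|apply sp_scal]|]].
    + eapply sp_mult; [exact Hgs | exact HPs |]. cbv beta. cbn [neg_degree prev_degree].
      intros m n m' n' (-> & _ & Hm) H. lia.
    + eapply sp_mono; [exact Hws|]. cbv beta. cbn [prev_degree]. intros m n H. lia.
    + eapply sp_mono; [exact Hns|]. cbv beta. intros m n H. lia.
    + intros j l. replace (RtoC (-1)) with (- RtoC 1)%C by (rewrite <- RtoC_opp; reflexivity). ring.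
  - apply Hk'.
  - apply Hk'.
  - cbn [rsum]. unfold kappa'. nra.
  - intros m n Hmn HnL. cbn [csum].
    rewrite (hat_ext _ _ _ (fun j l => gam j l * Phi j l + (w j l + RtoC (-1) * neg j l))%C).
    2:{ intros j l. replace (RtoC (-1)) with (- RtoC 1)%C by (rewrite <- RtoC_opp; reflexivity). ring. }
    rewrite hat_plus, hat_plus, hat_scal.
    destruct (Hvanish m n) as [-> | Hbad]; [|lia].
    rewrite (sp_hat_mult Ms Mt _ _ gam Phi _ _ HMs0 HMt0 Hgs HPs).
    + rewrite HPh by assumption.
      assert (Hg0 : hat Ms Mt gam 0 0 = RtoC (1 - 4 * v)).
      { unfold hat, gam, mean2.
        rewrite (cmean_ext Ms _ (fun j => RtoC (1 - 4 * Cmod (beta j) ^ 2))).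
        - rewrite cmean_RtoC. f_equal. unfold v.
          rewrite (rmean_ext Ms _ (fun j => 1 + (- 4) * Cmod (beta j) ^ 2)) by (intros; ring).
          rewrite rmean_plus, rmean_scal, rmean_const by assumption. ring.
        - intros j. rewrite (cmean_ext Mt _ (fun _ => RtoC (1 - 4 * Cmod (beta j) ^ 2))).
          + now apply cmean_const.
          + intros l. unfold char2. rewrite !ch_0, Cmul_conj_sqr, Cmult_conj, Cconj_RtoC,
              RtoC_minus, RtoC_mult. ring. }
      rewrite Hg0, <- csum_scal.
      rewrite (csum_ext K _ (fun k => RtoC (kappa' / 6) *
         (if (Nat.eqb n (d k) && Nat.eqb (m mod N k)%nat 0%nat)%bool
                then hat Ms Mt psi (Z.of_nat m) (Z.of_nat n) else 0))%C).
      2:{ intros k _. rewrite Cmult_assoc, <- RtoC_mult. f_equal. f_equal.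
          unfold kappa'. field. }
      assert (Hw : hat Ms Mt w (Z.of_nat m) (Z.of_nat n) = (RtoC (kappa' / 6) *
         (if (Nat.eqb n (d K) && Nat.eqb (m mod N K)%nat 0%nat)%bool
                then hat Ms Mt psi (Z.of_nat m) (Z.of_nat n) else 0))%C).
      { transitivity (RtoC kappa' * (cmean Ms (fun j => beta j * Cconj (ch Ms (Z.of_nat m) j))
          * cmean Mt (ch Mt (Z.of_nat (d K) - Z.of_nat n))))%C.
        - unfold hat. rewrite <- mean2_split, <- mean2_scal. apply mean2_ext; intros j l.
          unfold w, char2. rewrite <- ch_mul_conj, Cmult_conj. ring.
        - destruct (Nat.eqb_spec n (d K)) as [->|Hne]; simpl andb.
          + rewrite Z.sub_diag, cmean_ch_0, Hb4, hat_row by assumption.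
            replace (kappa' / 6) with (kappa' * (1 / 6)) by field.
            rewrite RtoC_mult. ring.
          + rewrite (cmean_ch Mt) by lia. ring. }
      rewrite Hw. ring.
    + intros r i (-> & _ & Hr). split; [reflexivity|lia].
    + intros r m' n' (_ & Hdiv & Hr) Hr0 HS. unfold apart.
      assert (HrN : (Z.of_nat (N K) <= Z.abs r)%Z).
      { apply Z.divide_pos_le; [lia|]. now apply Z.divide_abs_r. }
      destruct (Z.eq_dec n' (Z.of_nat n)) as [->|Hne]; [left|right; lia].
      lia.
Qed.

Definition grid_eval (Ms Mt : nat) (p : trigpoly) (x y : R) (j l : nat) : C :=
  trig_eval p (x + (2 * PI * INR j / INR Ms + 2 * PI * INR l / INR Mt))
              (y + 2 * PI * INR l / INR Mt).

Lemma grid_eval_cons (Ms Mt n1 n2 : nat) (c : C) (p : trigpoly) (x y : R) (j l : nat) :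
  grid_eval Ms Mt ((n1, n2, c) :: p) x y j l
  = (c * eC (INR n1 * x + INR n2 * y) * char2 Ms Mt (Z.of_nat n1) (Z.of_nat (n1 + n2)) j l
     + grid_eval Ms Mt p x y j l)%C.
Proof.
  unfold grid_eval. cbn [trig_eval fold_right]. fold (trig_eval p).
  f_equal. rewrite <- Cmult_assoc. f_equal.
  unfold char2, ch. rewrite <- !eC_plus, <- !INR_IZR_INZ, plus_INR. f_equal.
  unfold Rdiv. ring.
Qed.

Lemma mean2_char2_conj (Ms Mt : nat) (g : nat -> nat -> C) (a : C) (m n : Z) :
  mean2 Ms Mt (fun j l => a * char2 Ms Mt m n j l * Cconj (g j l))%C
  = (a * Cconj (hat Ms Mt g m n))%C.
Proof.
  unfold hat. rewrite mean2_conj, <- mean2_scal. apply mean2_ext; intros j l.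
  rewrite Cmult_conj, Cconj_conj. ring.
Qed.

Lemma csum_ind_setB (d N : nat -> nat) (L n1 n2 : nat) (a : C) :
  (forall k, (2 * d k < d (S k))%nat) -> (n1 + n2 < d L)%nat ->
  csum L (fun k => if (Nat.eqb (n1 + n2) (d k) && Nat.eqb (n1 mod N k)%nat 0%nat)%bool
                   then a else RtoC 0)
  = if Defs.ind (setB d N) n1 n2 then a else RtoC 0.
Proof.
  intros Hd HL. unfold Defs.ind.
  destruct (excluded_middle_informative (setB d N n1 n2)) as [[k [Hk Hdiv]]|Hn].
  - assert (Hkl : (k < L)%nat).
    { apply Nat.nle_gt. intros H. apply (doubling_mono d Hd) in H. lia. }
    rewrite (csum_single L k).
    + apply Nat.Lcm0.mod_divide in Hdiv. rewrite Hdiv, Hk, !Nat.eqb_refl. reflexivity.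
    + assumption.
    + intros i Hi Hne. destruct (Nat.eqb_spec (n1 + n2) (d i)) as [He|]; [|reflexivity].
      exfalso. destruct (Nat.lt_gt_cases i k) as [[H|H] _]; [assumption| |];
        apply (doubling_lt d Hd) in H; lia.
  - apply csum_zero. intros i Hi.
    destruct (Nat.eqb_spec (n1 + n2) (d i)) as [He|]; [|reflexivity].
    destruct (Nat.eqb_spec (n1 mod N i) 0) as [He'|]; [|reflexivity].
    exfalso. apply Hn. exists i. split; [assumption|]. now apply Nat.Lcm0.mod_divide.
Qed.

Definition phase (z : C) : C := if excluded_middle_informative (z = RtoC 0) then RtoC 0 else (z / RtoC (Cmod z))%C.

Lemma Cmod_phase (z : C) : Cmod (phase z) <= 1.
Proof.
  unfold phase. destruct (excluded_middle_informative (z = RtoC 0)) as [H|H].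
  - rewrite Cmod_0; lra.
  - pose proof (Cmod_gt_0 z) as [Hp _]. specialize (Hp H).
    rewrite Cmod_div, Cmod_R, Rabs_right by (try lra; intros He; apply RtoC_inj in He; lra).
    apply Req_le. field. lra.
Qed.

Lemma mul_conj_phase (z : C) : (z * Cconj (phase z))%C = RtoC (Cmod z).
Proof.
  unfold phase. destruct (excluded_middle_informative (z = RtoC 0)) as [H|H].
  - rewrite H, Cmod_0. ring.
  - pose proof (Cmod_gt_0 z) as [Hp _]. specialize (Hp H).
    assert (Hz : RtoC (Cmod z) <> RtoC 0) by (intros He; apply RtoC_inj in He; lra).
    rewrite Cdiv_conj, Cconj_RtoC by assumption.
    replace (z * (Cconj z / RtoC (Cmod z)))%C with (z * Cconj z / RtoC (Cmod z))%C
      by (field; assumption).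
    rewrite Cmul_conj_sqr, <- RtoC_div by lra. f_equal. field. lra.
Qed.

Definition rmean2 (Ms Mt : nat) (f : nat -> nat -> R) : R :=
  rmean Ms (fun j => rmean Mt (fun l => f j l)).

Lemma grid_multiplier_bound (d N : nat -> nat) (L Ms Mt : nat) (p : trigpoly) (x y : R) :
  (forall k, (1 <= d k)%nat) ->
  (forall k, (2 * d k < d (S k))%nat) ->
  (forall k, (8 * d k <= N (S k))%nat) ->
  (forall k, (1 <= N k)%nat) ->
  (forall k, (k <= L)%nat -> (10 * d L + N k < Ms)%nat) ->
  (neg_degree d L + d L < Mt)%nat ->
  List.Forall (fun a => let '(n1, n2, _) := a in (n1 + n2 < d L)%nat) p ->
  rmean2 Ms Mt (fun j l => Cmod (grid_eval Ms Mt (multiplier (setB d N) p) x y j l))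
  <= 8 * rmean2 Ms Mt (fun j l => Cmod (grid_eval Ms Mt p x y j l)).
Proof.
  intros Hd1 Hd HdN HN HMs HMt Hp.
  set (psi := fun j l => phase (grid_eval Ms Mt (multiplier (setB d N) p) x y j l)).
  destruct (bounded_interpolation d N L Ms Mt psi) with (K := L)
    as (Phi & kappa & HPb & _ & Hk01 & Hkl & HPh); auto.
  { intros; apply Cmod_phase. }
  assert (HMs0 : (0 < Ms)%nat) by (specialize (HMs 0%nat); lia).
  assert (HMt0 : (0 < Mt)%nat) by lia.
  assert (Hkappa : 3 / 4 <= kappa).
  { assert (rsum L (fun k => row_energy Ms Mt psi (d k)) <= 1); [|lra].
    unfold row_energy. rewrite <- rmean_rsum.
    rewrite <- (rmean_const Ms 1) by assumption. apply rmean_le; intros u.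
    unfold row. eapply Rle_trans; [apply (bessel Mt L (fun k => Z.of_nat (d k)))|].
    - assumption.
    - intros a b Hab. pose proof (doubling_lt d Hd a b). pose proof (doubling_mono d Hd b L). lia.
    - rewrite <- (rmean_const Mt 1) by assumption. apply rmean_le; intros l.
      pose proof (Cmod_phase (grid_eval Ms Mt (multiplier (setB d N) p) x y u l)).
      pose proof (Cmod_ge_0 (psi u l)). unfold psi in *. nra. }
  assert (Hdual : (mean2 Ms Mt (fun j l => grid_eval Ms Mt p x y j l * Cconj (Phi j l))
    = RtoC (kappa / 6) * mean2 Ms Mt (fun j l =>
        grid_eval Ms Mt (multiplier (setB d N) p) x y j l * Cconj (psi j l)))%C).
  { clearbody psi. induction Hp as [|[[n1 n2] c] p Hn Hp IH].
    - unfold grid_eval; simpl.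
      rewrite (mean2_ext Ms Mt (fun j l => 0 * Cconj (Phi j l))%C (fun j l => RtoC 0 * RtoC 0)%C)
        by (intros; ring).
      rewrite (mean2_ext Ms Mt (fun j l => 0 * Cconj (psi j l))%C (fun j l => RtoC 0 * RtoC 0)%C)
        by (intros; ring).
      rewrite mean2_scal. ring.
    - rewrite (mean2_ext Ms Mt _ (fun j l => c * eC (INR n1 * x + INR n2 * y) *
          char2 Ms Mt (Z.of_nat n1) (Z.of_nat (n1 + n2)) j l * Cconj (Phi j l)
          + grid_eval Ms Mt p x y j l * Cconj (Phi j l))%C)
        by (intros; rewrite grid_eval_cons; ring).
      rewrite mean2_plus, IH, mean2_char2_conj, HPh by lia.
      rewrite csum_scal, csum_ind_setB by assumption.
      cbn [multiplier filter]. fold (multiplier (setB d N) p).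
      destruct (Defs.ind (setB d N) n1 n2).
      + rewrite (mean2_ext Ms Mt (fun j l => grid_eval Ms Mt ((n1, n2, c) :: _) x y j l * _)%C
          (fun j l => c * eC (INR n1 * x + INR n2 * y) *
          char2 Ms Mt (Z.of_nat n1) (Z.of_nat (n1 + n2)) j l * Cconj (psi j l)
          + grid_eval Ms Mt (multiplier (setB d N) p) x y j l * Cconj (psi j l))%C)
          by (intros; rewrite grid_eval_cons; ring).
        rewrite mean2_plus, mean2_char2_conj, Cmult_conj, Cconj_RtoC. ring.
      + rewrite Cmult_conj, !Cconj_RtoC. ring. }
  rewrite (mean2_ext Ms Mt (fun j l => grid_eval Ms Mt (multiplier _ _) x y j l * _)%C
    (fun j l => RtoC (Cmod (grid_eval Ms Mt (multiplier (setB d N) p) x y j l)))) in Hdual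
    by (intros; apply mul_conj_phase).
  set (A := rmean2 Ms Mt (fun j l => Cmod (grid_eval Ms Mt (multiplier (setB d N) p) x y j l))).
  set (B := rmean2 Ms Mt (fun j l => Cmod (grid_eval Ms Mt p x y j l))).
  assert (HA : mean2 Ms Mt (fun j l =>
      RtoC (Cmod (grid_eval Ms Mt (multiplier (setB d N) p) x y j l))) = RtoC A).
  { unfold mean2, A, rmean2. rewrite <- cmean_RtoC. apply cmean_ext; intros j. apply cmean_RtoC. }
  rewrite HA, <- RtoC_mult in Hdual.
  assert (HA0 : 0 <= A).
  { apply rmean_nonneg; intros; apply rmean_nonneg; intros; apply Cmod_ge_0. }
  assert (HB : kappa / 6 * A <= B).
  { replace (kappa / 6 * A) with (Cmod (RtoC (kappa / 6 * A))).
    - rewrite <- Hdual. eapply Rle_trans; [apply Cmod_cmean|].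
      apply rmean_le; intros j. eapply Rle_trans; [apply Cmod_cmean|].
      apply rmean_le; intros l. rewrite Cmod_mult, Cmod_conj.
      pose proof (HPb j l). pose proof (Cmod_ge_0 (grid_eval Ms Mt p x y j l)). nra.
    - rewrite Cmod_R. apply Rabs_right. nra. }
  nra.
Qed.

(** * From grids to integrals *)

Lemma eC_lipschitz (a b : R) : Cmod (eC a - eC b)%C <= 2 * Rabs (a - b).
Proof.
  assert (Hc : Rabs (cos a - cos b) <= 1 * Rabs (a - b)).
  { apply (bounded_variation cos (fun x => - sin x)). intros t _. split.
    - apply is_derive_cos.
    - rewrite Rabs_Ropp. apply Rabs_le. apply SIN_bound. }
  assert (Hs : Rabs (sin a - sin b) <= 1 * Rabs (a - b)).
  { apply (bounded_variation sin cos). intros t _. split.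
    - apply is_derive_sin.
    - apply Rabs_le. apply COS_bound. }
  replace (eC a - eC b)%C with (RtoC (cos a - cos b) + Ci * RtoC (sin a - sin b))%C.
  - eapply Rle_trans; [apply Cmod_triangle|].
    rewrite Cmod_mult, !Cmod_R, Cmod_Ci. lra.
  - unfold eC. apply injective_projections; simpl; ring.
Qed.

Lemma continuous_lipschitz (f : R -> R) (L : R) :
  (forall x y, Rabs (f x - f y) <= L * Rabs (x - y)) -> forall x, continuous f x.
Proof.
  intros H x. apply continuity_pt_filterlim.
  intros eps Heps.
  assert (HL : 0 < Rabs L + 1) by (pose proof (Rabs_pos L); lra).
  exists (eps / (Rabs L + 1)). split; [apply Rdiv_lt_0_compat; lra|].
  intros y [_ Hy]. simpl in *. unfold R_dist, Rdist in *.
  eapply Rle_lt_trans; [apply H|].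
  apply Rle_lt_trans with ((Rabs L + 1) * Rabs (y - x)).
  - apply Rmult_le_compat_r; [apply Rabs_pos|]. pose proof (Rle_abs L). lra.
  - apply (Rmult_lt_compat_l (Rabs L + 1)) in Hy; [|assumption].
    replace ((Rabs L + 1) * (eps / (Rabs L + 1))) with eps in Hy by (field; lra). exact Hy.
Qed.

Lemma ex_RInt_lipschitz (f : R -> R) (L a b : R) :
  (forall x y, Rabs (f x - f y) <= L * Rabs (x - y)) -> ex_RInt f a b.
Proof.
  intros H. apply (ex_RInt_continuous f). intros x _. now apply (continuous_lipschitz f L).
Qed.

Lemma RInt_translate (f : R -> R) (L a : R) :
  (forall x y, Rabs (f x - f y) <= L * Rabs (x - y)) ->
  (forall x, f (x + 2 * PI) = f x) ->
  RInt (fun x => f (x + a)) 0 (2 * PI) = RInt f 0 (2 * PI).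
Proof.
  intros HL HP.
  assert (Hex : forall u v, ex_RInt f u v) by (intros; now apply (ex_RInt_lipschitz f L)).
  assert (Hshift : forall c u v, RInt (fun x => f (x + c)) u v = RInt f (u + c) (v + c)).
  { intros c u v. pose proof (RInt_comp_lin f 1 c u v (Hex _ _)) as H.
    rewrite !Rmult_1_l in H. rewrite <- H. apply RInt_ext. intros x _.
    change (scal 1 (f (1 * x + c))) with (1 * f (1 * x + c)). rewrite !Rmult_1_l. reflexivity. }
  rewrite Hshift, Rplus_0_l.
  pose proof (RInt_Chasles f 0 a (2 * PI + a) (Hex _ _) (Hex _ _)) as H1.
  pose proof (RInt_Chasles f 0 (2 * PI) (2 * PI + a) (Hex _ _) (Hex _ _)) as H2.
  assert (H3 : RInt f (2 * PI) (2 * PI + a) = RInt f 0 a).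
  { rewrite (RInt_ext f (fun x => f (x + - (2 * PI)))).
    - rewrite Hshift. f_equal; ring.
    - intros x _. rewrite <- (HP (x + - (2 * PI))). f_equal. ring. }
  change plus with Rplus in H1, H2. lra.
Qed.

Definition lip2 (f : R -> R -> R) : Prop :=
  exists L, forall x y x' y', Rabs (f x y - f x' y') <= L * (Rabs (x - x') + Rabs (y - y')).

Definition per2 (f : R -> R -> R) : Prop :=
  (forall x y, f (x + 2 * PI) y = f x y) /\ (forall x y, f x (y + 2 * PI) = f x y).

Definition int2 (f : R -> R -> R) : R :=
  RInt (fun x => RInt (fun y => f x y) 0 (2 * PI)) 0 (2 * PI).

Lemma lip2_inner (f : R -> R -> R) (x a b : R) : lip2 f -> ex_RInt (f x) a b.
Proof.
  intros [L H]. apply (ex_RInt_lipschitz _ L). intros u v.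
  specialize (H x u x v). rewrite Rminus_diag, Rabs_R0, Rplus_0_l in H. exact H.
Qed.

Lemma lip2_outer_lip (f : R -> R -> R) :
  lip2 f -> exists L, forall x x',
    Rabs (RInt (f x) 0 (2 * PI) - RInt (f x') 0 (2 * PI)) <= L * Rabs (x - x').
Proof.
  intros Hf. destruct Hf as [L HL] eqn:E. clear E. exists (2 * PI * L). intros x x'.
  assert (Hi : forall z, ex_RInt (f z) 0 (2 * PI)) by (intros; now apply lip2_inner).
  pose proof (RInt_minus (f x) (f x') 0 (2 * PI) (Hi x) (Hi x')) as Hm.
  change (minus (RInt (f x) 0 (2 * PI)) (RInt (f x') 0 (2 * PI))) with
    (RInt (f x) 0 (2 * PI) - RInt (f x') 0 (2 * PI)) in Hm.
  rewrite <- Hm. pose proof PI_RGT_0.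
  replace (2 * PI * L * Rabs (x - x')) with ((2 * PI - 0) * (L * Rabs (x - x'))) by ring.
  apply abs_RInt_le_const; [lra| |].
  - apply @ex_RInt_minus; apply Hi.
  - intros t _. specialize (HL x t x' t).
    rewrite Rminus_diag, Rabs_R0, Rplus_0_r in HL. exact HL.
Qed.

Lemma lip2_outer (f : R -> R -> R) (a b : R) :
  lip2 f -> ex_RInt (fun x => RInt (f x) 0 (2 * PI)) a b.
Proof.
  intros Hf. destruct (lip2_outer_lip f Hf) as [L HL]. now apply (ex_RInt_lipschitz _ L).
Qed.

Lemma int2_le (f g : R -> R -> R) :
  lip2 f -> lip2 g -> (forall x y, f x y <= g x y) -> int2 f <= int2 g.
Proof.
  intros Hf Hg H. pose proof PI_RGT_0. apply RInt_le; [lra|now apply lip2_outer|now apply lip2_outer|].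
  intros x _. apply RInt_le; [lra|now apply lip2_inner|now apply lip2_inner|]. auto.
Qed.

Lemma int2_plus (f g : R -> R -> R) :
  lip2 f -> lip2 g -> int2 (fun x y => f x y + g x y) = int2 f + int2 g.
Proof.
  intros Hf Hg. unfold int2.
  transitivity (RInt (fun x => RInt (f x) 0 (2 * PI) + RInt (g x) 0 (2 * PI)) 0 (2 * PI)).
  - apply RInt_ext; intros x _. apply (RInt_plus (f x) (g x)); now apply lip2_inner.
  - apply (RInt_plus (fun x => RInt (f x) 0 (2 * PI)) (fun x => RInt (g x) 0 (2 * PI)));
      now apply lip2_outer.
Qed.

Lemma int2_scal (c : R) (f : R -> R -> R) :
  lip2 f -> int2 (fun x y => c * f x y) = c * int2 f.
Proof.
  intros Hf. unfold int2.
  transitivity (RInt (fun x => c * RInt (f x) 0 (2 * PI)) 0 (2 * PI)).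
  - apply RInt_ext; intros x _. apply (RInt_scal (f x)); now apply lip2_inner.
  - apply (RInt_scal (fun x => RInt (f x) 0 (2 * PI))); now apply lip2_outer.
Qed.

Lemma int2_const (c : R) : int2 (fun _ _ => c) = 4 * PI ^ 2 * c.
Proof.
  unfold int2. transitivity (RInt (fun _ : R => 2 * PI * c) 0 (2 * PI)).
  - apply RInt_ext; intros x _.
    change (@eq R (RInt (fun _ : R => c) 0 (2 * PI)) (2 * PI * c)).
    transitivity ((2 * PI - 0) * c); [|ring].
    apply (RInt_const 0 (2 * PI) c).
  - transitivity ((2 * PI - 0) * (2 * PI * c)); [|ring].
    apply (RInt_const 0 (2 * PI) (2 * PI * c)).
Qed.

Lemma lip2_const (c : R) : lip2 (fun _ _ => c).
Proof. exists 0. intros. rewrite Rminus_diag, Rabs_R0. lra. Qed.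

Lemma lip2_plus (f g : R -> R -> R) : lip2 f -> lip2 g -> lip2 (fun x y => f x y + g x y).
Proof.
  intros [L HL] [L' HL']. exists (L + L'). intros x y x' y'.
  replace (f x y + g x y - (f x' y' + g x' y')) with ((f x y - f x' y') + (g x y - g x' y')) by ring.
  eapply Rle_trans; [apply Rabs_triang|].
  specialize (HL x y x' y'). specialize (HL' x y x' y'). lra.
Qed.

Lemma lip2_scal (c : R) (f : R -> R -> R) : lip2 f -> lip2 (fun x y => c * f x y).
Proof.
  intros [L HL]. exists (Rabs c * L). intros x y x' y'.
  rewrite <- Rmult_minus_distr_l, Rabs_mult, Rmult_assoc.
  apply Rmult_le_compat_l; [apply Rabs_pos|apply HL].
Qed.

Lemma lip2_translate (a b : R) (f : R -> R -> R) : lip2 f -> lip2 (fun x y => f (x + a) (y + b)).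
Proof.
  intros [L HL]. exists L. intros x y x' y'.
  replace (x - x') with (x + a - (x' + a)) by ring.
  replace (y - y') with (y + b - (y' + b)) by ring. apply HL.
Qed.

Lemma int2_translate (a b : R) (f : R -> R -> R) :
  lip2 f -> per2 f -> int2 (fun x y => f (x + a) (y + b)) = int2 f.
Proof.
  intros Hf [HP1 HP2]. unfold int2.
  rewrite (RInt_ext _ (fun x => RInt (f (x + a)) 0 (2 * PI))).
  - destruct (lip2_outer_lip f Hf) as [L HL].
    apply (RInt_translate (fun x => RInt (f x) 0 (2 * PI)) L); [exact HL|].
    intros x. apply RInt_ext. intros; apply HP1.
  - intros x _. destruct Hf as [L HL]. apply (RInt_translate (f (x + a)) L); [|auto].
    intros u v. specialize (HL (x + a) u (x + a) v).
    rewrite Rminus_diag, Rabs_R0, Rplus_0_l in HL. exact HL.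
Qed.

Lemma lip2_rsum (n : nat) (f : nat -> R -> R -> R) :
  (forall i, lip2 (f i)) -> lip2 (fun x y => rsum n (fun i => f i x y)).
Proof.
  intros H. induction n as [|n IH]; cbn [rsum]; [apply lip2_const|]. now apply lip2_plus.
Qed.

Lemma int2_rsum (n : nat) (f : nat -> R -> R -> R) :
  (forall i, lip2 (f i)) ->
  int2 (fun x y => rsum n (fun i => f i x y)) = rsum n (fun i => int2 (f i)).
Proof.
  intros H. induction n as [|n IH]; cbn [rsum].
  - rewrite int2_const. ring.
  - rewrite int2_plus, IH by (try apply lip2_rsum; auto). reflexivity.
Qed.

Lemma lip2_rmean (n : nat) (f : nat -> R -> R -> R) :
  (forall i, lip2 (f i)) -> lip2 (fun x y => rmean n (fun i => f i x y)).
Proof. intros H. apply (lip2_scal (/ INR n)). now apply lip2_rsum. Qed.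

Lemma int2_rmean (n : nat) (f : nat -> R -> R -> R) :
  (forall i, lip2 (f i)) ->
  int2 (fun x y => rmean n (fun i => f i x y)) = rmean n (fun i => int2 (f i)).
Proof.
  intros H. unfold rmean. rewrite (int2_scal _ (fun x y => rsum n (fun i => f i x y))).
  - now rewrite int2_rsum.
  - now apply lip2_rsum.
Qed.

Lemma trig_eval_cons (n1 n2 : nat) (c : C) (p : trigpoly) (x y : R) :
  trig_eval ((n1, n2, c) :: p) x y
  = (c * eC (INR n1 * x + INR n2 * y) + trig_eval p x y)%C.
Proof. reflexivity. Qed.

Lemma trig_eval_lip (p : trigpoly) : exists L, forall x y x' y',
  Cmod (trig_eval p x y - trig_eval p x' y')%C <= L * (Rabs (x - x') + Rabs (y - y')).
Proof.
  induction p as [|[[n1 n2] c] p [L HL]].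
  - exists 0. intros. simpl. replace (0 - 0)%C with (RtoC 0) by ring. rewrite Cmod_0. lra.
  - exists (Cmod c * (2 * (INR n1 + INR n2)) + L). intros x y x' y'.
    rewrite !trig_eval_cons.
    set (u := INR n1 * x + INR n2 * y). set (u' := INR n1 * x' + INR n2 * y').
    replace ((c * eC u + trig_eval p x y) - (c * eC u' + trig_eval p x' y'))%C
      with (c * (eC u - eC u') + (trig_eval p x y - trig_eval p x' y'))%C by ring.
    eapply Rle_trans; [apply Cmod_triangle|].
    rewrite Cmod_mult, Rmult_plus_distr_r. apply Rplus_le_compat; [|apply HL].
    rewrite Rmult_assoc. apply Rmult_le_compat_l; [apply Cmod_ge_0|].
    eapply Rle_trans; [apply eC_lipschitz|]. rewrite Rmult_assoc.
    apply Rmult_le_compat_l; [lra|].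
    replace (u - u') with (INR n1 * (x - x') + INR n2 * (y - y')) by (unfold u, u'; ring).
    eapply Rle_trans; [apply Rabs_triang|]. rewrite !Rabs_mult.
    rewrite !(Rabs_right (INR _)) by (apply Rle_ge, pos_INR).
    pose proof (pos_INR n1). pose proof (pos_INR n2).
    pose proof (Rabs_pos (x - x')). pose proof (Rabs_pos (y - y')). nra.
Qed.

Lemma trig_eval_lip2 (p : trigpoly) : lip2 (fun x y => Cmod (trig_eval p x y)).
Proof.
  destruct (trig_eval_lip p) as [L HL]. exists L. intros x y x' y'.
  specialize (HL x y x' y').
  assert (H1 : Cmod (trig_eval p x y) <=
     Cmod (trig_eval p x y - trig_eval p x' y')%C + Cmod (trig_eval p x' y')).
  { eapply Rle_trans; [|apply Cmod_triangle]. right. f_equal. ring. }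
  assert (H2 : Cmod (trig_eval p x' y') <=
     Cmod (trig_eval p x y - trig_eval p x' y')%C + Cmod (trig_eval p x y)).
  { rewrite <- (Cmod_opp (trig_eval p x y - trig_eval p x' y')%C).
    eapply Rle_trans; [|apply Cmod_triangle]. right. f_equal. ring. }
  apply Rabs_le. lra.
Qed.

Lemma trig_eval_per2 (p : trigpoly) : per2 (fun x y => Cmod (trig_eval p x y)).
Proof.
  split; intros x y; cbv beta; apply f_equal; induction p as [|[[n1 n2] c] p IH];
    try reflexivity; rewrite !trig_eval_cons, IH; do 2 f_equal.
  - replace (INR n1 * (x + 2 * PI) + INR n2 * y)
      with (INR n1 * x + INR n2 * y + INR n1 * (2 * PI)) by ring.
    rewrite eC_plus, eC_2PI_INR. ring.
  - replace (INR n1 * x + INR n2 * (y + 2 * PI))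
      with (INR n1 * x + INR n2 * y + INR n2 * (2 * PI)) by ring.
    rewrite eC_plus, eC_2PI_INR. ring.
Qed.

Lemma L1norm_int2 (p : trigpoly) :
  L1norm p = / (4 * PI ^ 2) * int2 (fun x y => Cmod (trig_eval p x y)).
Proof. reflexivity. Qed.

Lemma inv_4PI2_pos : 0 < / (4 * PI ^ 2).
Proof. apply Rinv_0_lt_compat. pose proof PI_RGT_0. nra. Qed.

Definition grid_norm (Ms Mt : nat) (p : trigpoly) (x y : R) : R :=
  rmean2 Ms Mt (fun j l => Cmod (grid_eval Ms Mt p x y j l)).

Lemma grid_norm_lip2 (Ms Mt : nat) (p : trigpoly) : lip2 (grid_norm Ms Mt p).
Proof.
  apply (lip2_rmean Ms (fun j x y => rmean Mt (fun l => Cmod (grid_eval Ms Mt p x y j l)))).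
  intros j. apply (lip2_rmean Mt (fun l x y => Cmod (grid_eval Ms Mt p x y j l))).
  intros l. apply (lip2_translate _ _ (fun x y => Cmod (trig_eval p x y))). apply trig_eval_lip2.
Qed.

Lemma L1norm_grid (Ms Mt : nat) (p : trigpoly) :
  (0 < Ms)%nat -> (0 < Mt)%nat ->
  L1norm p = / (4 * PI ^ 2) * int2 (grid_norm Ms Mt p).
Proof.
  intros Hs Ht. rewrite L1norm_int2. f_equal. symmetry. unfold grid_norm, rmean2.
  assert (Hl : forall j l, lip2 (fun x y => Cmod (grid_eval Ms Mt p x y j l))).
  { intros j l. apply (lip2_translate _ _ (fun x y => Cmod (trig_eval p x y))).
    apply trig_eval_lip2. }
  rewrite (int2_rmean Ms (fun j x y => rmean Mt (fun l => Cmod (grid_eval Ms Mt p x y j l))))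
    by (intros j; apply (lip2_rmean Mt (fun l x y => Cmod (grid_eval Ms Mt p x y j l))); auto).
  rewrite <- (rmean_const Ms (int2 (fun x y => Cmod (trig_eval p x y)))) by assumption.
  apply rmean_ext; intros j.
  rewrite (int2_rmean Mt (fun l x y => Cmod (grid_eval Ms Mt p x y j l))) by auto.
  rewrite <- (rmean_const Mt (int2 (fun x y => Cmod (trig_eval p x y)))) by assumption.
  apply rmean_ext; intros l. unfold grid_eval.
  apply (int2_translate _ _ (fun x y => Cmod (trig_eval p x y))).
  - apply trig_eval_lip2.
  - apply trig_eval_per2.
Qed.

Lemma L1norm_le_of_grid (Ms Mt : nat) (p q : trigpoly) (K : R) :
  (0 < Ms)%nat -> (0 < Mt)%nat ->
  (forall x y, grid_norm Ms Mt p x y <= K * grid_norm Ms Mt q x y) ->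
  L1norm p <= K * L1norm q.
Proof.
  intros Hs Ht H. rewrite !(L1norm_grid Ms Mt) by assumption.
  rewrite <- Rmult_assoc, (Rmult_comm K), Rmult_assoc.
  apply Rmult_le_compat_l; [apply Rlt_le, inv_4PI2_pos|].
  rewrite <- int2_scal by apply grid_norm_lip2.
  apply int2_le; auto using lip2_scal, grid_norm_lip2.
Qed.

Lemma L1norm_le_const (Ms Mt : nat) (p : trigpoly) (K : R) :
  (0 < Ms)%nat -> (0 < Mt)%nat -> (forall x y, grid_norm Ms Mt p x y <= K) -> L1norm p <= K.
Proof.
  intros Hs Ht H. rewrite (L1norm_grid Ms Mt) by assumption.
  apply Rle_trans with (/ (4 * PI ^ 2) * int2 (fun _ _ => K)).
  - apply Rmult_le_compat_l; [apply Rlt_le, inv_4PI2_pos|].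
    apply int2_le; auto using lip2_const, grid_norm_lip2.
  - rewrite int2_const. right. field. apply PI_neq0.
Qed.

Lemma L1norm_ge_const (Ms Mt : nat) (p : trigpoly) (K : R) :
  (0 < Ms)%nat -> (0 < Mt)%nat -> (forall x y, K <= grid_norm Ms Mt p x y) -> K <= L1norm p.
Proof.
  intros Hs Ht H. rewrite (L1norm_grid Ms Mt) by assumption.
  apply Rle_trans with (/ (4 * PI ^ 2) * int2 (fun _ _ => K)).
  - rewrite int2_const. right. field. apply PI_neq0.
  - apply Rmult_le_compat_l; [apply Rlt_le, inv_4PI2_pos|].
    apply int2_le; auto using lip2_const, grid_norm_lip2.
Qed.

(** * Sufficiency *)

Lemma nat_bound (f : nat -> nat) (L : nat) :
  exists B, forall k, (k <= L)%nat -> (f k <= B)%nat.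
Proof.
  induction L as [|L [B HB]].
  - exists (f 0%nat). intros k Hk. replace k with 0%nat by lia. lia.
  - exists (B + f (S L))%nat. intros k Hk.
    destruct (Nat.eq_dec k (S L)) as [->|]; [lia|]. specialize (HB k). lia.
Qed.

Lemma trigpoly_degree_bound (p : trigpoly) :
  exists B, List.Forall (fun a => let '(n1, n2, _) := a in (n1 + n2 < B)%nat) p.
Proof.
  induction p as [|[[n1 n2] c] p [B HB]].
  - exists 0%nat. constructor.
  - exists (S (n1 + n2 + B)). constructor; [lia|].
    eapply Forall_impl; [|exact HB]. intros [[m1 m2] c'] H. lia.
Qed.

Lemma multiplier_bound_separated (d N : nat -> nat) (p : trigpoly) :
  (forall k, (1 <= d k)%nat) ->
  (forall k, (2 * d k < d (S k))%nat) ->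
  (forall k, (8 * d k <= N (S k))%nat) ->
  (forall k, (1 <= N k)%nat) ->
  L1norm (multiplier (setB d N) p) <= 8 * L1norm p.
Proof.
  intros Hd1 Hd HdN HN.
  destruct (trigpoly_degree_bound p) as [L HL].
  assert (HdL : forall k, (k <= d k)%nat).
  { induction k as [|k IH]; [lia|]. specialize (Hd k). lia. }
  destruct (nat_bound N L) as [B HB].
  apply (L1norm_le_of_grid (10 * d L + B + 1) (neg_degree d L + d L + 1)); [lia|lia|].
  intros x y. apply (grid_multiplier_bound d N L); auto.
  - intros k Hk. specialize (HB k Hk). lia.
  - lia.
  - eapply Forall_impl; [|exact HL]. intros [[m1 m2] c'] H. cbv beta iota in *.
    specialize (HdL L). lia.
Qed.

Lemma strict_incr_lt (d : nat -> nat) :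
  (forall k, (d k < d (S k))%nat) -> forall k l, (k < l)%nat -> (d k < d l)%nat.
Proof.
  intros H k l Hkl. induction Hkl as [|l _ IH]; [apply H|]. specialize (H l). lia.
Qed.

Lemma ind_setB_split (d N : nat -> nat) (r n1 n2 : nat) (a : C) :
  (0 < r)%nat -> (forall k, (d k < d (S k))%nat) ->
  (if Defs.ind (setB d N) n1 n2 then a else RtoC 0)
  = csum r (fun rho => if Defs.ind (setB (fun k => d (r * k + rho)%nat)
                                         (fun k => N (r * k + rho)%nat)) n1 n2
                       then a else RtoC 0).
Proof.
  intros Hr Hd. pose proof (strict_incr_lt d Hd) as Hlt.
  unfold Defs.ind at 1.
  destruct (excluded_middle_informative (setB d N n1 n2)) as [[k [Hk Hdiv]]|Hn].
  - assert (Hmod : (k mod r < r)%nat) by (apply Nat.mod_upper_bound; lia).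
    pose proof (Nat.div_mod_eq k r) as Hkr.
    rewrite (csum_single r (k mod r)); [|assumption|].
    + unfold Defs.ind. destruct excluded_middle_informative as [_|Hno]; [reflexivity|].
      exfalso. apply Hno. exists (k / r)%nat. rewrite <- Hkr. auto.
    + intros i Hi Hne. unfold Defs.ind.
      destruct excluded_middle_informative as [[k' [Hk' _]]|_]; [|reflexivity].
      exfalso. rewrite Hk in Hk'.
      assert (k = (r * k' + i)%nat).
      { destruct (Nat.lt_trichotomy k (r * k' + i)) as [H|[H|H]]; [|assumption|];
          apply Hlt in H; lia. }
      apply Hne. subst k. symmetry.
      rewrite Nat.add_comm, Nat.mul_comm, Nat.Div0.mod_add. now apply Nat.mod_small.
  - symmetry. apply csum_zero. intros i Hi. unfold Defs.ind.
    destruct excluded_middle_informative as [[k' [Hk' Hdiv]]|_]; [|reflexivity].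
    exfalso. apply Hn. exists (r * k' + i)%nat. auto.
Qed.

Lemma multiplier_split (d N : nat -> nat) (r : nat) (p : trigpoly) (x y : R) :
  (0 < r)%nat -> (forall k, (d k < d (S k))%nat) ->
  trig_eval (multiplier (setB d N) p) x y
  = csum r (fun rho => trig_eval (multiplier
      (setB (fun k => d (r * k + rho)%nat) (fun k => N (r * k + rho)%nat)) p) x y).
Proof.
  intros Hr Hd.
  assert (Hm : forall E n1 n2 c q, trig_eval (multiplier E ((n1, n2, c) :: q)) x y
     = ((if Defs.ind E n1 n2 then c * eC (INR n1 * x + INR n2 * y) else RtoC 0)
        + trig_eval (multiplier E q) x y)%C).
  { intros E n1 n2 c q. cbn [multiplier filter]. fold (multiplier E q).
    destruct (Defs.ind E n1 n2); [apply trig_eval_cons | ring]. }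
  induction p as [|[[n1 n2] c] p IH].
  - symmetry. now apply csum_zero.
  - rewrite Hm, IH, (ind_setB_split d N r) by assumption.
    rewrite <- csum_plus. apply csum_ext; intros rho _. symmetry. apply Hm.
Qed.

Lemma L1norm_multiplier_split (d N : nat -> nat) (r : nat) (p : trigpoly) :
  (0 < r)%nat -> (forall k, (d k < d (S k))%nat) ->
  L1norm (multiplier (setB d N) p)
  <= rsum r (fun rho => L1norm (multiplier
      (setB (fun k => d (r * k + rho)%nat) (fun k => N (r * k + rho)%nat)) p)).
Proof.
  intros Hr Hd.
  set (f := fun rho x y => Cmod (trig_eval (multiplier
      (setB (fun k => d (r * k + rho)%nat) (fun k => N (r * k + rho)%nat)) p) x y)).
  assert (Hf : forall rho, lip2 (f rho)) by (intros; apply trig_eval_lip2).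
  rewrite L1norm_int2.
  apply Rle_trans with (/ (4 * PI ^ 2) * int2 (fun x y => rsum r (fun rho => f rho x y))).
  - apply Rmult_le_compat_l; [apply Rlt_le, inv_4PI2_pos|].
    apply int2_le; [apply trig_eval_lip2 | now apply lip2_rsum |].
    intros x y. rewrite (multiplier_split d N r) by assumption. apply Cmod_csum.
  - rewrite int2_rsum, <- rsum_scal by assumption. apply Req_le, rsum_ext. reflexivity.
Qed.

Lemma divisor_chain_pos (N : nat -> nat) :
  (forall k, Nat.divide (N k) (N (S k))) -> (forall k, (N k < N (S k))%nat) ->
  forall k, (1 <= N k)%nat.
Proof.
  intros Hdiv Hlt k. destruct (Nat.eq_dec (N k) 0) as [H0|]; [|lia].
  destruct (Hdiv k) as [c Hc]. specialize (Hlt k). rewrite H0 in Hc. lia.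
Qed.

Lemma divisor_chain_double (N : nat -> nat) :
  (forall k, Nat.divide (N k) (N (S k))) -> (forall k, (N k < N (S k))%nat) ->
  forall k, (2 * N k <= N (S k))%nat.
Proof.
  intros Hdiv Hlt k. destruct (Hdiv k) as [c Hc]. specialize (Hlt k).
  assert (c <> 0 /\ c <> 1)%nat by (split; intros ->; lia). nia.
Qed.

Lemma doubling_pow (N : nat -> nat) :
  (forall k, (2 * N k <= N (S k))%nat) ->
  forall b k, (2 ^ b * N k <= N (k + b))%nat.
Proof.
  intros H b k. induction b as [|b IH].
  - rewrite Nat.add_0_r. simpl. lia.
  - rewrite Nat.add_succ_r, Nat.pow_succ_r'. specialize (H (k + b)%nat). lia.
Qed.

Lemma lacunary_incr (d : nat -> nat) : lacunary d -> forall k, (d k < d (S k))%nat.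
Proof.
  intros [Hpos [q [Hq H]]] k. apply INR_lt. specialize (H k). specialize (Hpos k).
  apply lt_0_INR in Hpos. nra.
Qed.

Lemma lacunary_gap (d : nat -> nat) :
  lacunary d -> exists r, forall k s, (r <= s)%nat -> (2 * d k < d (k + s))%nat.
Proof.
  intros Hd. pose proof (strict_incr_lt d (lacunary_incr d Hd)) as Hlt.
  destruct Hd as [Hpos [q [Hq H]]].
  assert (Hpow : forall k s, q ^ s * INR (d k) <= INR (d (k + s)%nat)).
  { intros k s. induction s as [|s IH].
    - rewrite Nat.add_0_r. simpl. lra.
    - rewrite Nat.add_succ_r. specialize (H (k + s)%nat). simpl. nra. }
  destruct (Pow_x_infinity q) with (b := 3) as [r Hr].
  { rewrite Rabs_right; lra. }
  exists r. intros k s Hs. apply INR_lt. rewrite mult_INR. change (INR 2) with 2.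
  specialize (Hr s Hs). rewrite Rabs_right in Hr by (apply Rle_ge, pow_le; lra).
  specialize (Hpow k s). specialize (Hpos k). apply lt_0_INR in Hpos. nra.
Qed.

Lemma idempotent_of_bound (d N : nat -> nat) (a : nat) (C0 : R) :
  lacunary d ->
  (forall k, Nat.divide (N k) (N (S k))) ->
  (forall k, (N k < N (S k))%nat) ->
  (forall k, INR (d k) <= C0 * INR (N (k + a)%nat)) ->
  in_idempotent_ring (setB d N).
Proof.
  intros Hd Hdiv HNlt HC.
  pose proof (lacunary_incr d Hd) as Hinc.
  pose proof (divisor_chain_pos N Hdiv HNlt) as HN1.
  pose proof (divisor_chain_double N Hdiv HNlt) as HN2.
  destruct (lacunary_gap d Hd) as [r0 Hr0].
  destruct Hd as [Hdpos _].
  destruct (INR_unbounded (8 * C0)) as [b Hb].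
  assert (HbN : forall s k, (a + b <= s)%nat -> (8 * d k <= N (k + s))%nat).
  { intros s k Hs. apply Nat.le_trans with (N (k + a + b)%nat).
    - apply INR_le. rewrite mult_INR. change (INR 8) with (1 + 1 + 1 + 1 + 1 + 1 + 1 + 1).
      pose proof (doubling_pow N HN2 b (k + a)) as Hp. apply le_INR in Hp.
      rewrite mult_INR in Hp. specialize (HC k).
      assert (INR b <= INR (2 ^ b)).
      { apply le_INR. apply Nat.lt_le_incl, Nat.pow_gt_lin_r. lia. }
      pose proof (pos_INR (N (k + a)%nat)). nra.
    - destruct (Nat.eq_dec (k + a + b) (k + s)) as [->|]; [lia|].
      apply Nat.lt_le_incl, (strict_incr_lt N HNlt). lia. }
  set (r := (r0 + a + b + 1)%nat).
  exists (INR r * 8). intros p.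
  eapply Rle_trans; [apply (L1norm_multiplier_split d N r); [unfold r; lia|assumption]|].
  rewrite Rmult_assoc, <- rsum_const. apply rsum_le. intros rho _.
  apply multiplier_bound_separated.
  - intros k. apply Hdpos.
  - intros k. replace (r * S k + rho)%nat with (r * k + rho + r)%nat by lia.
    apply Hr0. unfold r; lia.
  - intros k. replace (r * S k + rho)%nat with (r * k + rho + r)%nat by lia.
    apply HbN. unfold r; lia.
  - intros k. apply HN1.
Qed.

(** * Necessity *)

Lemma rsum_ge_term (n i : nat) (f : nat -> R) :
  (i < n)%nat -> (forall j, (j < n)%nat -> 0 <= f j) -> f i <= rsum n f.
Proof.
  induction n as [|n IH]; [lia|]. intros Hi Hf. cbn [rsum].
  destruct (Nat.eq_dec i n) as [->|Hne].
  - assert (0 <= rsum n f) by (apply rsum_nonneg; auto with arith). lra.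
  - assert (f i <= rsum n f) by (apply IH; [lia|auto with arith]).
    specialize (Hf n). assert (0 <= f n) by (apply Hf; lia). lra.
Qed.

Lemma rsum_blocks (q m : nat) (f : nat -> R) :
  rsum (q * m) f = rsum q (fun b => rsum m (fun s => f (b * m + s)%nat)).
Proof.
  induction q as [|q IH]; [reflexivity|].
  replace (S q * m)%nat with (q * m + m)%nat by lia. rewrite rsum_add, IH. reflexivity.
Qed.

Lemma rsum_ge_blocks (q m : nat) (f : nat -> R) (s : nat -> nat) :
  (forall i, 0 <= f i) -> (forall b, (s b < m)%nat) ->
  rsum q (fun b => f (b * m + s b)%nat) <= rsum (q * m) f.
Proof.
  intros Hf Hs. rewrite rsum_blocks. apply rsum_le. intros b _.
  apply (rsum_ge_term m (s b) (fun s => f (b * m + s)%nat)); auto.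
Qed.

Lemma rsum_shift (M c : nat) (f : nat -> R) :
  (forall j, f (M + j)%nat = f j) -> rsum M (fun j => f (c + j)%nat) = rsum M f.
Proof.
  intros Hf. induction c as [|c IH]; [reflexivity|].
  rewrite <- IH. set (g := fun j => f (c + j)%nat).
  pose proof (rsum_add M 1 g) as H1. pose proof (rsum_add 1 M g) as H2.
  rewrite (Nat.add_comm 1 M) in H2. cbn [rsum] in H1, H2.
  assert (Hg : g (M + 0)%nat = g 0%nat).
  { unfold g. replace (c + (M + 0))%nat with (M + (c + 0))%nat by lia. apply Hf. }
  rewrite Hg in H1.
  replace (rsum M (fun j => f (S c + j)%nat)) with (rsum M (fun i => g (1 + i)%nat)).
  - lra.
  - apply rsum_ext; intros i _. unfold g. f_equal. lia.
Qed.

Fixpoint poly_sum (n : nat) (f : nat -> trigpoly) : trigpoly :=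
  match n with O => nil | S m => poly_sum m f ++ f m end.

Lemma trig_eval_app (p q : trigpoly) (x y : R) :
  trig_eval (p ++ q) x y = (trig_eval p x y + trig_eval q x y)%C.
Proof.
  induction p as [|[[n1 n2] c] p IH].
  - simpl. ring.
  - rewrite <- app_comm_cons, !trig_eval_cons, IH. ring.
Qed.

Lemma trig_eval_poly_sum (n : nat) (f : nat -> trigpoly) (x y : R) :
  trig_eval (poly_sum n f) x y = csum n (fun i => trig_eval (f i) x y).
Proof.
  induction n as [|n IH]; [reflexivity|]. cbn [poly_sum csum]. now rewrite trig_eval_app, IH.
Qed.

Lemma multiplier_poly_sum (E : nat -> nat -> Prop) (n : nat) (f : nat -> trigpoly) :
  multiplier E (poly_sum n f) = poly_sum n (fun i => multiplier E (f i)).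
Proof.
  induction n as [|n IH]; [reflexivity|]. cbn [poly_sum].
  rewrite <- IH. apply filter_app.
Qed.

Lemma ind_setB_on_line (d N : nat -> nat) (k n1 n2 : nat) :
  (forall k, (d k < d (S k))%nat) -> (n1 + n2)%nat = d k ->
  Defs.ind (setB d N) n1 n2 = Nat.eqb (n1 mod N k)%nat 0%nat.
Proof.
  intros Hd Hk. pose proof (strict_incr_lt d Hd) as Hlt. unfold Defs.ind.
  destruct excluded_middle_informative as [[k' [Hk' Hdiv]]|Hn].
  - assert (k' = k) as ->.
    { destruct (Nat.lt_trichotomy k' k) as [H|[H|H]]; [|assumption|]; apply Hlt in H; lia. }
    apply Nat.Lcm0.mod_divide in Hdiv. now rewrite Hdiv.
  - symmetry. apply Nat.eqb_neq. intros H. apply Hn. exists k. split; [assumption|].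
    now apply Nat.Lcm0.mod_divide.
Qed.

(* [n1] runs over [M + x - y]: on each line this is a Fejer kernel of order [M],
   shifted to nonnegative frequencies. *)
Definition fejer_line (M D x y : nat) : trigpoly :=
  (((M + x - y)%nat, (D - (M + x - y))%nat, RtoC (/ INR M)) :: nil).

Definition fejer_test (M n : nat) (e : nat -> nat) : trigpoly :=
  poly_sum n (fun i => poly_sum M (fun x => poly_sum M (fun y => fejer_line M (e i) x y))).

Definition fejer_part (M m : nat) (s : R) : C :=
  csum M (fun x => csum M (fun y =>
    if Nat.eqb ((M + x - y) mod m)%nat 0%nat
    then (RtoC (/ INR M) * eC (INR (M + x - y) * s))%C else RtoC 0)).

Lemma trig_eval_fejer_line (M D x y : nat) (X Y : R) :
  (M + x - y <= D)%nat ->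
  trig_eval (fejer_line M D x y) X Y
  = (eC (INR D * Y) * (RtoC (/ INR M) * eC (INR (M + x - y) * (X - Y))))%C.
Proof.
  intros H. unfold fejer_line. rewrite trig_eval_cons. cbn [trig_eval fold_right].
  replace (INR (M + x - y) * X + INR (D - (M + x - y)) * Y)
    with (INR D * Y + INR (M + x - y) * (X - Y)).
  - rewrite eC_plus. ring.
  - rewrite (minus_INR D) by assumption. ring.
Qed.

Lemma trig_eval_fejer_multiplier (d N : nat -> nat) (k M n : nat) (X Y : R) :
  (forall k, (d k < d (S k))%nat) -> (2 * M < d k)%nat ->
  trig_eval (multiplier (setB d N) (fejer_test M n (fun i => d (k + i)%nat))) X Y
  = csum n (fun i => (eC (INR (d (k + i)%nat) * Y) * fejer_part M (N (k + i)%nat) (X - Y))%C).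
Proof.
  intros Hd HM. unfold fejer_test, fejer_part.
  rewrite multiplier_poly_sum, trig_eval_poly_sum. apply csum_ext; intros i _.
  rewrite multiplier_poly_sum, trig_eval_poly_sum, <- csum_scal. apply csum_ext; intros x Hx.
  rewrite multiplier_poly_sum, trig_eval_poly_sum, <- csum_scal. apply csum_ext; intros y Hy.
  assert (Hki : (d k <= d (k + i))%nat).
  { destruct i as [|i]; [rewrite Nat.add_0_r; lia|].
    apply Nat.lt_le_incl, (strict_incr_lt d Hd). lia. }
  unfold multiplier, fejer_line at 1. cbn [filter].
  rewrite (ind_setB_on_line d N (k + i)) by (try assumption; lia).
  destruct (Nat.eqb _ _).
  - apply trig_eval_fejer_line. lia.
  - simpl. ring.
Qed.

Lemma trig_eval_fejer_test (d : nat -> nat) (k M n : nat) (X Y : R) :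
  (forall k, (d k < d (S k))%nat) -> (2 * M < d k)%nat ->
  trig_eval (fejer_test M n (fun i => d (k + i)%nat)) X Y
  = (csum n (fun i => eC (INR (d (k + i)%nat) * Y)) * fejer_part M 1 (X - Y))%C.
Proof.
  intros Hd HM. unfold fejer_test, fejer_part.
  rewrite trig_eval_poly_sum, Cmult_comm, <- csum_scal. apply csum_ext; intros i _.
  rewrite Cmult_comm, trig_eval_poly_sum, <- csum_scal. apply csum_ext; intros x Hx.
  rewrite trig_eval_poly_sum, <- csum_scal. apply csum_ext; intros y Hy.
  assert (Hki : (d k <= d (k + i))%nat).
  { destruct i as [|i]; [rewrite Nat.add_0_r; lia|].
    apply Nat.lt_le_incl, (strict_incr_lt d Hd). lia. }
  rewrite Nat.mod_1_r. apply trig_eval_fejer_line. lia.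
Qed.

Lemma eC_INR_shift (M x y : nat) (s : R) :
  (y < M)%nat ->
  eC (INR (M + x - y) * s) = (eC (INR M * s) * (eC (INR x * s) * Cconj (eC (INR y * s))))%C.
Proof.
  intros Hy. rewrite <- eC_opp, <- !eC_plus. f_equal.
  rewrite minus_INR, plus_INR by lia. ring.
Qed.

Lemma Cmod_fejer_part_1 (M : nat) (s : R) :
  Cmod (fejer_part M 1 s) = / INR M * Cmod (csum M (fun x => eC (INR x * s))) ^ 2.
Proof.
  set (D := csum M (fun x => eC (INR x * s))).
  assert (H : fejer_part M 1 s = (RtoC (/ INR M) * eC (INR M * s) * (D * Cconj D))%C).
  { unfold fejer_part, D. rewrite csum_conj.
    rewrite (Cmult_comm (csum M _)), Cmult_assoc, <- csum_scal. apply csum_ext; intros x _.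
    rewrite <- Cmult_assoc, (Cmult_comm _ (eC (INR x * s))), !Cmult_assoc, <- csum_scal.
    apply csum_ext; intros y Hy. rewrite Nat.mod_1_r. cbn [Nat.eqb].
    rewrite eC_INR_shift by assumption. ring. }
  rewrite H, Cmul_conj_sqr, !Cmod_mult, Cmod_eC, !Cmod_R.
  rewrite !Rabs_right by (apply Rle_ge; first [apply inv_INR_nonneg | apply pow2_ge_0]).
  ring.
Qed.

Lemma grid_eval_def (Ms Mt : nat) (p : trigpoly) (x y : R) (j l : nat) :
  grid_eval Ms Mt p x y j l =
  trig_eval p (y + 2 * PI * INR l / INR Mt + (x - y + 2 * PI * INR j / INR Ms))
              (y + 2 * PI * INR l / INR Mt).
Proof. unfold grid_eval. f_equal. ring. Qed.

Lemma eC_grid (Mt e l : nat) (y : R) :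
  eC (INR e * (y + 2 * PI * INR l / INR Mt)) = (eC (INR e * y) * ch Mt (Z.of_nat e) l)%C.
Proof.
  unfold ch. rewrite <- eC_plus, <- INR_IZR_INZ. f_equal. ring.
Qed.

Lemma fejer_test_norm (d : nat -> nat) (k M n : nat) :
  (forall k, (d k < d (S k))%nat) -> (2 * M < d k)%nat -> (0 < M)%nat ->
  L1norm (fejer_test M n (fun i => d (k + i)%nat)) <= sqrt (INR n).
Proof.
  intros Hd HM HM0. pose proof (strict_incr_lt d Hd) as Hlt.
  set (Mt := (d (k + n) + 1)%nat).
  apply (L1norm_le_const M Mt); [assumption|unfold Mt; lia|].
  intros x y. unfold grid_norm, rmean2.
  set (A := rmean Mt (fun l => Cmod (csum n (fun i =>
      (eC (INR (d (k + i)%nat) * y) * ch Mt (Z.of_nat (d (k + i)%nat)) l)%C)))).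
  rewrite (rmean_ext M _ (fun j => A * / INR M * Cmod (csum M (fun a =>
      eC (INR a * (x - y)) * ch M (Z.of_nat a) j)%C) ^ 2)).
  - rewrite rmean_scal, (parseval M M Z.of_nat) by (try assumption; intros; lia).
    rewrite (rsum_ext M _ (fun _ => 1)) by (intros; rewrite Cmod_eC; ring).
    rewrite rsum_const.
    replace (A * / INR M * (INR M * 1)) with A by (field; apply not_0_INR; lia).
    assert (HA : A ^ 2 <= INR n).
    { eapply Rle_trans; [apply rmean_sqr_le; unfold Mt; lia|]. cbv beta.
      rewrite (parseval Mt n (fun i => Z.of_nat (d (k + i)%nat))
        (fun i => eC (INR (d (k + i)%nat) * y))).
      - rewrite (rsum_ext n _ (fun _ => 1)) by (intros; rewrite Cmod_eC; ring).
        rewrite rsum_const. lra.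
      - unfold Mt; lia.
      - intros a b Hab. pose proof (Hlt (k + a) (k + b))%nat.
        pose proof (Hlt (k + b) (k + n))%nat. unfold Mt. lia. }
    rewrite <- (sqrt_pow2 A).
    + now apply sqrt_le_1_alt.
    + apply rmean_nonneg; intros; apply Cmod_ge_0.
  - intros j. rewrite (rmean_ext Mt _ (fun l => Cmod (fejer_part M 1 (x - y + 2 * PI * INR j / INR M)) *
      Cmod (csum n (fun i =>
      (eC (INR (d (k + i)%nat) * y) * ch Mt (Z.of_nat (d (k + i)%nat)) l)%C)))).
    + rewrite rmean_scal. fold A. rewrite Cmod_fejer_part_1.
      rewrite (csum_ext M (fun a => eC (INR a * (x - y + 2 * PI * INR j / INR M)))
        (fun a => eC (INR a * (x - y)) * ch M (Z.of_nat a) j)%C); [ring|].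
      intros; apply eC_grid.
    + intros l. rewrite grid_eval_def, trig_eval_fejer_test, Cmod_mult, Rmult_comm by assumption.
      f_equal.
      * f_equal. f_equal. ring.
      * f_equal. apply csum_ext; intros; apply eC_grid.
Qed.

Lemma Cmod_ge_re (z : C) : fst z <= Cmod z.
Proof. eapply Rle_trans; [apply Rle_abs | apply re_le_Cmod]. Qed.

Lemma fst_csum (n : nat) (f : nat -> C) : fst (csum n f) = rsum n (fun i => fst (f i)).
Proof. induction n as [|n IH]; [reflexivity|]. cbn [csum rsum]. rewrite <- IH. reflexivity. Qed.

Lemma fejer_part_lower (m q v : nat) (delta : R) :
  (0 < m)%nat -> (0 < q)%nat ->
  0 <= delta <= 2 * PI / INR (6 * (q * m)) ->
  INR q / 2 <= Cmod (fejer_part (q * m) m (delta + 2 * PI * INR v / INR m)).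
Proof.
  intros Hm Hq Hdelta.
  set (M := (q * m)%nat) in *. set (s := delta + 2 * PI * INR v / INR m).
  assert (HM : (0 < M)%nat) by (unfold M; nia).
  assert (HMr : 0 < INR M) by (now apply lt_0_INR).
  assert (Hmr : 0 < INR m) by (now apply lt_0_INR).
  replace (Cmod (fejer_part M m s)) with (Cmod (Cconj (eC (INR M * s)) * fejer_part M m s)%C)
    by (rewrite Cmod_mult, Cmod_conj, Cmod_eC; ring).
  eapply Rle_trans; [|apply Cmod_ge_re].
  set (t := fun x y : nat => if Nat.eqb ((M + x - y) mod m)%nat 0%nat then 1 else 0).
  apply Rle_trans with (rsum M (fun x => rsum M (fun y => / INR M * / 2 * t x y))).
  - rewrite (rsum_ext M _ (fun x => / INR M * / 2 * rsum M (t x)))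
      by (intros; apply rsum_scal).
    rewrite rsum_scal.
    assert (Hcount : forall x, INR q <= rsum M (t x)).
    { intros x. replace (INR q) with (rsum q (fun _ => 1)) by (rewrite rsum_const; ring).
      eapply Rle_trans; [|apply (rsum_ge_blocks q m (t x) (fun _ => ((M + x) mod m)%nat))].
      - apply Req_le, rsum_ext. intros b _. unfold t.
        replace (M + x - (b * m + (M + x) mod m))%nat with (((M + x) / m - b) * m)%nat.
        + now rewrite Nat.Div0.mod_mul.
        + pose proof (Nat.div_mod_eq (M + x) m). nia.
      - intros y. unfold t. destruct (Nat.eqb _ _); lra.
      - intros _. apply Nat.mod_upper_bound. lia. }
    apply Rle_trans with (/ INR M * / 2 * rsum M (fun _ => INR q)).
    + rewrite rsum_const. right. field. lra.
    + apply Rmult_le_compat_l; [|now apply rsum_le].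
      apply Rmult_le_pos; [|lra]. apply Rlt_le, Rinv_0_lt_compat. lra.
  - unfold fejer_part. rewrite <- csum_scal, fst_csum. apply rsum_le. intros x Hx.
    rewrite <- csum_scal, fst_csum. apply rsum_le. intros y Hy. unfold t.
    destruct (Nat.eqb_spec ((M + x - y) mod m) 0) as [He|He].
    + rewrite eC_INR_shift by assumption.
      assert (Hz : exists z : Z, (Z.of_nat x - Z.of_nat y = z * Z.of_nat m)%Z).
      { apply Nat.Lcm0.mod_divide in He. destruct He as [c Hc].
        exists (Z.of_nat c - Z.of_nat q)%Z. unfold M in *. nia. }
      destruct Hz as [z Hz]. apply (f_equal IZR) in Hz.
      rewrite minus_IZR, mult_IZR, <- !INR_IZR_INZ in Hz.
      replace (Cconj (eC (INR M * s)) * (RtoC (/ INR M) * (eC (INR M * s)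
          * (eC (INR x * s) * Cconj (eC (INR y * s))))))%C
        with (RtoC (/ INR M) * eC ((INR x - INR y) * delta))%C.
      * set (th := (INR x - INR y) * delta).
        assert (Hth : Rabs th <= PI / 3).
        { unfold th. rewrite Rabs_mult, (Rabs_right delta) by lra.
          apply Rle_trans with (INR M * (2 * PI / INR (6 * M))).
          - apply Rmult_le_compat; [apply Rabs_pos|lra| |lra].
            apply lt_INR in Hx. apply lt_INR in Hy.
            pose proof (pos_INR x). pose proof (pos_INR y).
            apply Rabs_le. lra.
          - rewrite mult_INR. right. change (INR 6) with (1 + 1 + 1 + 1 + 1 + 1). field. lra. }
        assert (Hcos : 1 / 2 <= cos th).
        { rewrite <- cos_PI3. pose proof PI_RGT_0.
          destruct (Rle_dec 0 th) as [Hp|Hp].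
          - rewrite Rabs_right in Hth by lra. apply cos_decr_1; lra.
          - rewrite Rabs_left in Hth by lra. rewrite <- (cos_neg th).
            apply cos_decr_1; lra. }
        cbn [fst RtoC eC Cmult snd].
        assert (0 < / INR M) by (apply Rinv_0_lt_compat; lra).
        replace (fst (RtoC (/ INR M) * eC th)%C) with (/ INR M * cos th)
          by (unfold eC; simpl; ring). nra.
      * transitivity (RtoC (/ INR M) * ((eC (INR M * s) * Cconj (eC (INR M * s))) *
          (eC (INR x * s) * Cconj (eC (INR y * s)))))%C; [|ring].
        rewrite Cmul_conj_sqr, Cmod_eC, <- eC_opp, <- eC_plus.
        replace (INR x * s + - (INR y * s)) with ((INR x - INR y) * delta + IZR (z * Z.of_nat v) * (2 * PI)).
        -- rewrite eC_plus, eC_2PI_IZR. replace (1 ^ 2) with 1 by ring. ring.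
        -- unfold s. rewrite mult_IZR, <- INR_IZR_INZ.
           transitivity ((INR x - INR y) * delta + (INR x - INR y) * (2 * PI * INR v / INR m));
             [|ring].
           rewrite Hz. field. lra.
    + simpl. lra.
Qed.

Lemma grid_point_near_period (M : nat) (s : R) :
  (0 < M)%nat ->
  exists (c : nat) (delta : R) (z : Z),
    0 <= delta <= 2 * PI / INR M /\
    s + 2 * PI * INR c / INR M = delta + IZR z * (2 * PI).
Proof.
  intros HM. assert (HMr : 0 < INR M) by now apply lt_0_INR.
  pose proof PI_RGT_0 as HPI.
  set (u := s * INR M / (2 * PI)). set (e := Int_part u).
  destruct (base_Int_part u) as [H1 H2]. fold e in H1, H2.
  assert (Hs : s = 2 * PI / INR M * u) by (unfold u; field; lra).
  exists (Z.to_nat ((- e) mod Z.of_nat M)), (2 * PI / INR M * (u - IZR e)),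
    (- ((- e) / Z.of_nat M))%Z.
  assert (Hp : 0 < 2 * PI / INR M) by (apply Rdiv_lt_0_compat; lra).
  split; [split; nra|].
  assert (Hc : INR (Z.to_nat ((- e) mod Z.of_nat M)) =
     - IZR e - INR M * IZR ((- e) / Z.of_nat M)).
  { rewrite !INR_IZR_INZ, Z2Nat.id by (apply Z.mod_pos_bound; lia).
    rewrite Z.mod_eq by lia. rewrite minus_IZR, mult_IZR, opp_IZR. ring. }
  rewrite Hc, Hs, opp_IZR. field. lra.
Qed.

Lemma fejer_part_periodic (M m : nat) (s : R) (z : Z) :
  fejer_part M m (s + IZR z * (2 * PI)) = fejer_part M m s.
Proof.
  unfold fejer_part. apply csum_ext; intros x _. apply csum_ext; intros y _.
  destruct (Nat.eqb _ _); [|reflexivity]. f_equal.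
  rewrite Rmult_plus_distr_l, eC_plus, <- Rmult_assoc, INR_IZR_INZ, <- mult_IZR, eC_2PI_IZR.
  ring.
Qed.

(* Summation by parts along [q (S i) %| q i]: the sum telescopes to the first [q i] dividing [w]. *)
Lemma divisor_telescope (n w : nat) (q : nat -> nat) (B : R) :
  (forall i, (i < n)%nat -> Nat.divide (q (S i)) (q i)) -> 0 <= B ->
  (forall i, (i <= n)%nat -> Nat.divide (q i) w -> INR (q i) <= B) ->
  rsum n (fun i => (INR (q i) - INR (q (S i))) * (if Nat.eqb (w mod q i)%nat 0%nat then 1 else 0))
  <= B.
Proof.
  intros Hq HB Hw.
  set (t := fun i => (INR (q i) - INR (q (S i))) * (if Nat.eqb (w mod q i)%nat 0%nat then 1 else 0)).
  assert (H : forall j, (j <= n)%nat ->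
    (Nat.divide (q j) w -> rsum j t <= B - INR (q j)) /\ (~ Nat.divide (q j) w -> rsum j t = 0)).
  { induction j as [|j IH]; intros Hj.
    - cbn [rsum]. split; [|reflexivity]. intros Hd. specialize (Hw 0%nat Hj Hd). lra.
    - destruct IH as [IH1 IH2]; [lia|]. specialize (Hq j Hj). cbn [rsum]. unfold t at 2 4.
      destruct (Nat.eqb_spec (w mod q j) 0) as [He|He].
      + apply Nat.Lcm0.mod_divide in He. specialize (IH1 He). split.
        * intros _. lra.
        * intros Hn. exfalso. apply Hn. now apply Nat.divide_trans with (q j).
      + assert (Hn : ~ Nat.divide (q j) w) by (intros Hd; apply He; now apply Nat.Lcm0.mod_divide).
        rewrite (IH2 Hn). split; [|intros; ring].
        intros Hd. specialize (Hw (S j) Hj Hd). lra. }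
  destruct (H n (le_n n)) as [H1 H2].
  destruct (classic (Nat.divide (q n) w)) as [Hd|Hd].
  - specialize (H1 Hd). pose proof (pos_INR (q n)). lra.
  - rewrite (H2 Hd). assumption.
Qed.

Lemma divisor_chain_divide (N : nat -> nat) :
  (forall k, Nat.divide (N k) (N (S k))) -> forall k l, (k <= l)%nat -> Nat.divide (N k) (N l).
Proof.
  intros H k l Hkl. induction Hkl as [|l _ IH]; [apply Nat.divide_refl|].
  now apply Nat.divide_trans with (N l).
Qed.

Lemma coefficient_le_mean (Mt n i : nat) (f : nat -> nat) (c : nat -> C) :
  (0 < Mt)%nat -> (i < n)%nat ->
  (forall a b, (a < b)%nat -> (f a < f b)%nat) ->
  (forall a, (a < n)%nat -> (f a < Mt)%nat) ->
  Cmod (c i) <= rmean Mt (fun l => Cmod (csum n (fun a => c a * ch Mt (Z.of_nat (f a)) l)%C)).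
Proof.
  intros HMt Hi Hf Hn.
  assert (Hc : c i = cmean Mt (fun l => csum n (fun a => c a * ch Mt (Z.of_nat (f a)) l)
      * Cconj (ch Mt (Z.of_nat (f i)) l))%C).
  { rewrite (cmean_ext Mt _ (fun l => csum n (fun a =>
       c a * ch Mt (Z.of_nat (f a) - Z.of_nat (f i)) l)%C)).
    - rewrite cmean_csum, (csum_single n i).
      + rewrite cmean_scal, Z.sub_diag, cmean_ch_0 by assumption. ring.
      + assumption.
      + intros a Ha Hne. pose proof (Hn a Ha). pose proof (Hn i Hi).
        assert (f a <> f i).
        { destruct (Nat.lt_trichotomy a i) as [H'|[H'|H']]; [|lia|]; apply Hf in H'; lia. }
        rewrite cmean_scal, cmean_ch by lia. ring.
    - intros l. rewrite Cmult_comm, <- csum_scal. apply csum_ext; intros a _.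
      rewrite <- ch_mul_conj. ring. }
  rewrite Hc at 1. eapply Rle_trans; [apply Cmod_cmean|]. apply rmean_le; intros l.
  rewrite Cmod_mult, Cmod_conj, Cmod_ch. lra.
Qed.

Lemma fejer_multiplier_norm (d N : nat -> nat) (k n : nat) :
  (forall k, (d k < d (S k))%nat) ->
  (forall k, Nat.divide (N k) (N (S k))) ->
  (forall k, (N k < N (S k))%nat) ->
  (2 * N (k + n) < d k)%nat ->
  INR n / 24 <= L1norm (multiplier (setB d N)
     (fejer_test (N (k + n)%nat) (S n) (fun i => d (k + i)%nat))).
Proof.
  intros Hd Hdiv HNlt HM.
  pose proof (divisor_chain_pos N Hdiv HNlt) as HN1.
  pose proof (divisor_chain_double N Hdiv HNlt) as HN2.
  pose proof (strict_incr_lt d Hd) as Hlt.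
  set (M := N (k + n)%nat) in *.
  assert (HM0 : (0 < M)%nat) by (apply HN1).
  set (Mt := (d (k + n) + 1)%nat).
  assert (HMt : (0 < Mt)%nat) by (unfold Mt; lia).
  apply (L1norm_ge_const (M * 6) Mt); [lia|assumption|].
  intros x y. unfold grid_norm, rmean2.
  set (h := fun s => rmean Mt (fun l => Cmod (csum (S n) (fun i =>
     (eC (INR (d (k + i)%nat) * y) * fejer_part M (N (k + i)%nat) s)
      * ch Mt (Z.of_nat (d (k + i)%nat)) l)%C))).
  rewrite (rmean_ext (M * 6) _ (fun j => h (x - y + 2 * PI * INR j / INR (M * 6)))).
  2:{ intros j. apply rmean_ext; intros l.
      rewrite grid_eval_def, trig_eval_fejer_multiplier by assumption. f_equal.
      apply csum_ext; intros i _. rewrite eC_grid.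
      replace (y + 2 * PI * INR l / INR Mt + (x - y + 2 * PI * INR j / INR (M * 6)) -
        (y + 2 * PI * INR l / INR Mt)) with (x - y + 2 * PI * INR j / INR (M * 6)) by ring.
      ring. }
  assert (Hh0 : forall s, 0 <= h s) by (intros; apply rmean_nonneg; intros; apply Cmod_ge_0).
  assert (Hhp : forall s z, h (s + IZR z * (2 * PI)) = h s).
  { intros s z. apply rmean_ext; intros l. f_equal. apply csum_ext; intros i _.
    now rewrite fejer_part_periodic. }
  assert (Hhb : forall s i, (i <= n)%nat -> Cmod (fejer_part M (N (k + i)%nat) s) <= h s).
  { intros s i Hi.
    replace (Cmod (fejer_part M (N (k + i)%nat) s))
      with (Cmod (eC (INR (d (k + i)%nat) * y) * fejer_part M (N (k + i)%nat) s)%C)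
      by (rewrite Cmod_mult, Cmod_eC; ring).
    apply (coefficient_le_mean Mt (S n) i (fun i => d (k + i)%nat)
      (fun i => eC (INR (d (k + i)%nat) * y) * fejer_part M (N (k + i)%nat) s)%C).
    - assumption.
    - lia.
    - intros a b Hab. apply Hlt. lia.
    - intros a Ha. unfold Mt. destruct (Nat.eq_dec a n) as [->|]; [lia|].
      pose proof (Hlt (k + a) (k + n))%nat. lia. }
  destruct (grid_point_near_period (M * 6) (x - y)) as (c & delta & z & Hdelta & Hc); [lia|].
  set (H := fun j => h (x - y + 2 * PI * INR j / INR (M * 6))).
  assert (HM6 : 0 < INR (M * 6)) by (apply lt_0_INR; lia).
  assert (HMr : 0 < INR M) by (apply lt_0_INR; lia).
  assert (Hshift : rsum (M * 6) (fun j => H (c + j)%nat) = rsum (M * 6) H).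
  { apply rsum_shift. intros j. unfold H. rewrite <- (Hhp (x - y + 2 * PI * INR j / INR (M * 6)) 1%Z).
    apply f_equal.
    rewrite plus_INR. field. lra. }
  change (INR n / 24 <= rmean (M * 6) H). unfold rmean. rewrite <- Hshift.
  assert (Hval : forall w, H (c + w * 6)%nat = h (delta + 2 * PI * INR w / INR M)).
  { intros w. unfold H. rewrite <- (Hhp (delta + _) z). apply f_equal.
    rewrite plus_INR. rewrite !mult_INR in *. change (INR 6) with (1 + 1 + 1 + 1 + 1 + 1) in *.
    transitivity (delta + IZR z * (2 * PI) + 2 * PI * INR w / INR M); [rewrite <- Hc|ring].
    field. lra. }
  set (q := fun i => (M / N (k + i))%nat).
  assert (HqM : forall i, (i <= n)%nat -> M = (q i * N (k + i))%nat).
  { intros i Hi. unfold q. rewrite Nat.mul_comm. apply Nat.Div0.div_exact.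
    apply Nat.Lcm0.mod_divide. apply (divisor_chain_divide N Hdiv). lia. }
  assert (Hqc : forall i, (i < n)%nat -> exists c, (2 <= c)%nat /\ q i = (c * q (S i))%nat).
  { intros i Hi. pose proof (HqM i) as H1. pose proof (HqM (S i)) as H2.
    rewrite Nat.add_succ_r in H2. destruct (Hdiv (k + i)%nat) as [e He].
    specialize (HN2 (k + i)%nat). specialize (HN1 (k + i)%nat).
    exists e. split; [nia|].
    assert (q i * N (k + i) = e * q (S i) * N (k + i))%nat by nia. nia. }
  set (T := fun w => rsum n (fun i => (INR (q i) - INR (q (S i))) *
     (if Nat.eqb (w mod q i)%nat 0%nat then 1 else 0))).
  assert (HT : forall w, T w <= 2 * h (delta + 2 * PI * INR w / INR M)).
  { intros w. apply divisor_telescope.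
    - intros i Hi. destruct (Hqc i Hi) as [e [_ He]]. now exists e.
    - specialize (Hh0 (delta + 2 * PI * INR w / INR M)). lra.
    - intros i Hi [v Hv]. pose proof (HqM i Hi) as HMi. specialize (HN1 (k + i)%nat).
      assert (Hq0 : (0 < q i)%nat) by nia.
      pose proof (fejer_part_lower (N (k + i)%nat) (q i) v delta) as Hlow.
      rewrite <- HMi, (Nat.mul_comm 6) in Hlow. specialize (Hlow HN1 Hq0 Hdelta).
      assert (Hvi : 2 * PI * INR w / INR M = 2 * PI * INR v / INR (N (k + i)%nat)).
      { apply lt_0_INR in Hq0. apply lt_0_INR in HN1.
        rewrite HMi, Hv, !mult_INR. field. lra. }
      rewrite Hvi. specialize (Hhb (delta + 2 * PI * INR v / INR (N (k + i)%nat)) i Hi). lra. }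
  assert (Hsum : INR n * INR M / 2 <= rsum M T).
  { unfold T. rewrite rsum_swap.
    replace (INR n * INR M / 2) with (rsum n (fun _ => INR M / 2)) by (rewrite rsum_const; field).
    apply rsum_le. intros i Hi. rewrite rsum_scal.
    pose proof (HqM i) as HMi. destruct (Hqc i Hi) as [e [He Hqe]].
    specialize (HN1 (k + i)%nat).
    assert (Hq0 : (0 < q i)%nat) by nia.
    assert (Hcnt : INR (N (k + i)%nat) <= rsum M (fun w => if Nat.eqb (w mod q i)%nat 0%nat then 1 else 0)).
    { rewrite HMi by lia. rewrite (Nat.mul_comm (q i)).
      replace (INR (N (k + i)%nat)) with (rsum (N (k + i)%nat) (fun _ => 1))
        by (rewrite rsum_const; ring).
      eapply Rle_trans; [|apply (rsum_ge_blocks _ (q i)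
        (fun w => if Nat.eqb (w mod q i)%nat 0%nat then 1 else 0) (fun _ => 0%nat))].
      - apply Req_le, rsum_ext. intros b _. now rewrite Nat.add_0_r, Nat.Div0.mod_mul.
      - intros w. destruct (Nat.eqb _ _); lra.
      - auto. }
    assert (Hhalf : INR (q i) / 2 <= INR (q i) - INR (q (S i))).
    { rewrite Hqe, mult_INR. apply le_INR in He. change (INR 2) with 2 in He.
      pose proof (pos_INR (q (S i))). nra. }
    apply Rle_trans with (INR (q i) / 2 * INR (N (k + i)%nat)).
    - rewrite HMi, mult_INR by lia. lra.
    - pose proof (pos_INR (q i)). pose proof (pos_INR (N (k + i)%nat)).
      apply Rmult_le_compat; lra. }
  assert (Hfin : INR n * INR M / 4 <= rsum (M * 6) (fun j => H (c + j)%nat)).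
  { eapply Rle_trans; [|apply (rsum_ge_blocks M 6 (fun j => H (c + j)%nat) (fun _ => 0%nat))].
    - apply Rle_trans with (rsum M (fun w => / 2 * T w)); [rewrite rsum_scal; lra|].
      apply rsum_le. intros w _. rewrite Nat.add_0_r, Hval. specialize (HT w). lra.
    - intros j. apply Hh0.
    - intros _. lia. }
  apply Rmult_le_reg_l with (INR (M * 6)); [assumption|].
  rewrite <- Rmult_assoc, Rinv_r, Rmult_1_l by lra.
  eapply Rle_trans; [|exact Hfin]. rewrite mult_INR.
  change (INR 6) with (1 + 1 + 1 + 1 + 1 + 1). lra.
Qed.

Theorem theorem2p2 (d N : nat -> nat) :
  lacunary d ->
  (forall k, Nat.divide (N k) (N (S k))) ->
  (forall k, (N k < N (S k))%nat) ->
  ((exists (a : nat) (C : R), forall k, INR (d k) <= C * INR (N (k + a)%nat))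
   <-> in_idempotent_ring (setB d N)).
Proof.
  intros Hd Hdiv HNlt. split.
  - intros (a & C0 & HC). now apply (idempotent_of_bound d N a C0).
  - intros [K HK]. apply NNPP. intros Hno.
    pose proof (lacunary_incr d Hd) as Hinc.
    destruct (INR_unbounded (1152 * K ^ 2 + 1)) as [n Hn].
    assert (Hk : exists k, (2 * N (k + n) < d k)%nat).
    { apply NNPP. intros Hk. apply Hno. exists n, 2. intros k.
      apply Rnot_lt_le. intros Hlt. apply Hk. exists k. apply INR_lt.
      rewrite mult_INR. exact Hlt. }
    destruct Hk as [k Hk].
    pose proof (divisor_chain_pos N Hdiv HNlt (k + n)) as HM.
    pose proof (fejer_multiplier_norm d N k n Hinc Hdiv HNlt Hk) as Hlow.
    pose proof (fejer_test_norm d k (N (k + n)%nat) (S n) Hinc Hk HM) as Hup.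
    set (p := fejer_test (N (k + n)%nat) (S n) (fun i => d (k + i)%nat)) in *.
    specialize (HK p).
    assert (Hp0 : 0 <= L1norm p).
    { apply (L1norm_ge_const 1 1); [lia|lia|]. intros x y.
      apply rmean_nonneg; intros; apply rmean_nonneg; intros; apply Cmod_ge_0. }
    assert (Hs0 : 0 <= sqrt (INR (S n))) by apply sqrt_pos.
    assert (Hss : sqrt (INR (S n)) ^ 2 = INR n + 1).
    { rewrite pow2_sqrt by apply pos_INR. apply S_INR. }
    assert (Habs : INR n / 24 <= Rabs K * sqrt (INR (S n))).
    { apply Rle_trans with (Rabs K * L1norm p).
      - pose proof (Rle_abs K). nra.
      - apply Rmult_le_compat_l; [apply Rabs_pos|assumption]. }
    assert (Hn1 : 1 <= INR n) by (pose proof (pow2_ge_0 K); lra).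
    assert (Hsq : (INR n / 24) ^ 2 <= K ^ 2 * (INR n + 1)).
    { rewrite <- Hss, <- (pow2_abs K), <- Rpow_mult_distr. apply pow_incr. lra. }
    pose proof (pow2_ge_0 K). nra.
Qed.
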